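(* Let $\beta\in\{1,2,4\}$, $n\ge1$. For every $r>0$ and all $q_1,\dots,q_n\ge0$ with $0<q_1+\dots+q_n<1$, the negative binomial ensemble $\mathrm{NB}(r,q_1,\dots,q_n)$ on $\mathbb{H}_{n,\beta}$ is a Meixner ensemble with parameters $A=\frac1{2r+1}$, $B=\frac{2r}{2r+1}$, $C=0$.
   Context: For $\beta=1,2,4$, $\mathbb{H}_{n,\beta}$ is the real vector space of $n\times n$ real symmetric, complex Hermitian, respectively quaternionic Hermitian matrices; $\mathcal{K}_{n,\beta}$ is $O(n)$, $U(n)$, $Sp(n)$ (quaternionic unitary matrices) respectively. A law $\mu$ on $\mathbb{H}_{n,\beta}$ is rotation invariant if $U\mathbf XU^*\sim\mathbf X$ for all $U\in\mathcal{K}_{n,\beta}$ when $\mathbf X\sim\mu$. $\mu$ is a Meixner ensemble with parameters $A,B,C\in\mathbb R$ if it is rotation invariant, has finite second moments, and for $\mathbf X,\mathbf Y$ independent with law $\mu$ and $\mathbf S=\mathbf X+\mathbf Y$ one has $\mathbb{E}((\mathbf X-\mathbf Y)^2|\mathbf S)=A\mathbf S^2+B\mathbf S+C\mathbf I_n$. Let $\mathbf I_{m,n}$ be the $n\times n$ diagonal matrix with $m$ ones followed by $n-m$ zeros and let $\mu_m$ be the law of $\mathbf U\mathbf I_{m,n}\mathbf U^*$ with $\mathbf U$ Haar distributed on $\mathcal{K}_{n,\beta}$. The Bernoulli ensemble with parameters $q_1,\dots,q_n\ge0$, $q_1+\dots+q_n\le1$, is the law $q_0\delta_{\mathbf 0}+q_1\mu_1+\dots+q_{n-1}\mu_{n-1}+q_n\delta_{\mathbf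 I_n}$ with $q_0=1-(q_1+\dots+q_n)$. $\mathrm{NB}(r,q_1,\dots,q_n)$ is the law of $\sum_{k=1}^N\mathbf X_k$ (equal to $\mathbf 0$ if $N=0$), where $p=1-(q_1+\dots+q_n)$, $P(N=j)=\frac{\Gamma(r+j)}{\Gamma(r)j!}p^r(1-p)^j$ for $j=0,1,2,\dots$, and $N$ is independent of the i.i.d. sequence $\mathbf X_1,\mathbf X_2,\dots$ of Bernoulli ensembles with parameters $q_1/(1-p),\dots,q_n/(1-p)$. *)

(* Defs.v *)
From HB Require Import structures.
From mathcomp Require Import all_boot all_order all_algebra.
From mathcomp Require Import ring complex.
From mathcomp Require Import all_classical all_reals all_analysis.

Set Implicit Arguments.
Unset Strict Implicit.
Unset Printing Implicit Defensive.

Import Order.TTheory GRing.Theory Num.Theory.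
Import numFieldNormedType.Exports.

Local Open Scope classical_set_scope.
Local Open Scope ring_scope.

(* [Quat a b c d] is the quaternion a + b i + c j + d k. *)
Record quat (R : realType) : Type := Quat { qr : R; qi : R; qj : R; qk : R }.

Section QuaternionRing.
Variable R : realType.
Implicit Types x y z : quat R.

Definition quat_tuple x : R * R * R * R := (qr x, qi x, qj x, qk x).
Definition tuple_quat (t : R * R * R * R) : quat R :=
  Quat t.1.1.1 t.1.1.2 t.1.2 t.2.

Lemma quat_tupleK : cancel quat_tuple tuple_quat. Proof. by case. Qed.

HB.instance Definition _ := Equality.copy (quat R) (can_type quat_tupleK).
HB.instance Definition _ := Choice.copy (quat R) (can_type quat_tupleK).

Definition quat0 : quat R := Quat 0 0 0 0.
Definition quat1 : quat R := Quat 1 0 0 0.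
Definition addq x y : quat R :=
  Quat (qr x + qr y) (qi x + qi y) (qj x + qj y) (qk x + qk y).
Definition oppq x : quat R := Quat (- qr x) (- qi x) (- qj x) (- qk x).
Definition mulq x y : quat R :=
  Quat (qr x * qr y - qi x * qi y - qj x * qj y - qk x * qk y)
       (qr x * qi y + qi x * qr y + qj x * qk y - qk x * qj y)
       (qr x * qj y - qi x * qk y + qj x * qr y + qk x * qi y)
       (qr x * qk y + qi x * qj y - qj x * qi y + qk x * qr y).

Fact addqA : associative addq.
Proof. by move=> x y z; rewrite /addq /= !addrA. Qed.
Fact addqC : commutative addq.
Proof. by move=> x y; congr Quat => /=; rewrite addrC. Qed.
Fact add0q : left_id quat0 addq.
Proof. by case=> *; rewrite /addq /= !add0r. Qed.
Fact addNq : left_inverse quat0 oppq addq.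
Proof. by case=> *; rewrite /addq /= !addNr. Qed.

HB.instance Definition _ :=
  GRing.isZmodule.Build (quat R) addqA addqC add0q addNq.

Fact mulqA : associative mulq.
Proof. by move=> x y z; congr Quat => /=; ring. Qed.
Fact mul1q : left_id quat1 mulq.
Proof. by case=> *; congr Quat => /=; ring. Qed.
Fact mulq1 : right_id quat1 mulq.
Proof. by case=> *; congr Quat => /=; ring. Qed.
Fact mulqDl : left_distributive mulq addq.
Proof. by move=> x y z; congr Quat => /=; ring. Qed.
Fact mulqDr : right_distributive mulq addq.
Proof. by move=> x y z; congr Quat => /=; ring. Qed.
Fact quat1_neq0 : quat1 != quat0.
Proof. by apply/eqP => -[] /eqP; rewrite oner_eq0. Qed.

HB.instance Definition _ := GRing.Zmodule_isNzRing.Build (quat R)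
  mulqA mul1q mulq1 mulqDl mulqDr quat1_neq0.

End QuaternionRing.

Variant dyson := beta1 | beta2 | beta4.

Definition coef (R : realType) (b : dyson) : nzRingType :=
  match b with
  | beta1 => R
  | beta2 => R[i]
  | beta4 => quat R
  end.

Definition coef_conj (R : realType) (b : dyson) : coef R b -> coef R b :=
  match b with
  | beta1 => fun x : R => x
  | beta2 => fun x : R[i] => conjc x
  | beta4 => fun x : quat R => Quat (qr x) (- qi x) (- qj x) (- qk x)
  end.

Definition coef_of_real (R : realType) (b : dyson) (a : R) : coef R b :=
  match b with
  | beta1 => a
  | beta2 => (Complex a 0 : R[i])
  | beta4 => Quat a 0 0 0
  end.

Definition beta_nat (b : dyson) : nat :=
  match b with beta1 => 1 | beta2 => 2 | beta4 => 4 end.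

Definition coef_coord (R : realType) (b : dyson) :
    coef R b -> (beta_nat b).-tuple R :=
  match b with
  | beta1 => fun x : R => [tuple x]
  | beta2 => fun x : R[i] => [tuple complex.Re x; complex.Im x]
  | beta4 => fun x : quat R => [tuple qr x; qi x; qj x; qk x]
  end.

Definition bmx (R : realType) (b : dyson) (n : nat) : Type := 'M[coef R b]_n.

HB.instance Definition _ (R : realType) (b : dyson) (n : nat) :=
  GRing.Zmodule.on (bmx R b n).
HB.instance Definition _ (R : realType) (b : dyson) (n : nat) :=
  isPointed.Build (bmx R b n) 0.

Definition mx_coord (R : realType) (b : dyson) (n : nat) (i j : 'I_n)
    (k : 'I_(beta_nat b)) (M : bmx R b n) : R :=
  tnth (coef_coord (M i j)) k.

(* The Borel sigma-algebra of the finite-dimensional real vector space of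
   matrices: the one generated by the real coordinates of the entries. *)
Section MatrixBorel.
Variables (R : realType) (b : dyson) (n : nat).

Definition bmx_generators : set (set (bmx R b n)) :=
  [set A | exists i j k,
     preimage_set_system setT (@mx_coord R b n i j k) measurable A].

Definition bmx_measurable : set (set (bmx R b n)) := <<s bmx_generators >>.

Let bmx_measurable0 : bmx_measurable set0.
Proof. exact: sigma_algebra0. Qed.

Let bmx_measurableC (A : set (bmx R b n)) :
  bmx_measurable A -> bmx_measurable (~` A).
Proof. exact: sigma_algebraC. Qed.

Let bmx_measurableU (F : (set (bmx R b n))^nat) :
  (forall i, bmx_measurable (F i)) -> bmx_measurable (\bigcup_i F i).
Proof. exact: sigma_algebra_bigcup. Qed.

Definition bmx_display : measure_display. Proof. by constructor. Qed.

HB.instance Definition _ := @isMeasurable.Build bmx_display (bmx R b n)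
  bmx_measurable bmx_measurable0 bmx_measurableC bmx_measurableU.

End MatrixBorel.

Definition mx_adj (R : realType) (b : dyson) (n : nat) (M : bmx R b n) :
    bmx R b n :=
  map_mx (@coef_conj R b) M^T.

Definition hermitian_space (R : realType) (b : dyson) (n : nat) :
    set (bmx R b n) :=
  [set M | mx_adj M = M].

Definition unitary_group (R : realType) (b : dyson) (n : nat) :
    set (bmx R b n) :=
  [set U | U *m mx_adj U = 1%:M /\ mx_adj U *m U = 1%:M].

Definition rotate (R : realType) (b : dyson) (n : nat) (U M : bmx R b n) :
    bmx R b n :=
  U *m M *m mx_adj U.

(* A law on the space of Hermitian matrices is represented by a Borel
   probability measure on all matrices giving mass 1 to the Hermitian ones. *)
Definition law_on_hermitian (R : realType) (b : dyson) (n : nat)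
    (mu : probability (bmx R b n) R) : Prop :=
  mu (@hermitian_space R b n) = 1%E.

Definition is_haar (R : realType) (b : dyson) (n : nat)
    (haar : probability (bmx R b n) R) : Prop :=
  haar (@unitary_group R b n) = 1%E /\
  forall V : bmx R b n, unitary_group V ->
  forall B : set (bmx R b n), measurable B ->
    haar [set U | B (V *m U)] = haar B.

Definition rotation_invariant (R : realType) (b : dyson) (n : nat)
    (mu : probability (bmx R b n) R) : Prop :=
  forall U : bmx R b n, unitary_group U ->
  forall B : set (bmx R b n), measurable B -> mu (rotate U @^-1` B) = mu B.

Definition finite_second_moments (R : realType) (b : dyson) (n : nat)
    (mu : probability (bmx R b n) R) : Prop :=
  forall (i j : 'I_n) (k : 'I_(beta_nat b)),
    (\int[mu]_M ((mx_coord i j k M) ^+ 2)%:E < +oo)%E.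

Definition sigma_of (d d' : measure_display) (T : measurableType d)
    (T' : measurableType d') (S : T -> T') : set (set T) :=
  preimage_set_system setT S measurable.

(* [Z] is a version of the conditional expectation of [W] given [G]. *)
Definition is_cond_exp (d : measure_display) (T : measurableType d)
    (R : realType) (P : probability T R) (G : set (set T)) (W Z : T -> R) :
    Prop :=
  [/\ P.-integrable setT (EFin \o W),
      P.-integrable setT (EFin \o Z),
      forall B : set R, measurable B -> G (Z @^-1` B)
    & forall E : set T, G E ->
        (\int[P]_(w in E) (W w)%:E = \int[P]_(w in E) (Z w)%:E)%E].

Definition is_cond_exp_mx (d : measure_display) (T : measurableType d)
    (R : realType) (b : dyson) (n : nat) (P : probability T R)
    (G : set (set T)) (W Z : T -> bmx R b n) : Prop :=
  forall (i j : 'I_n) (k : 'I_(beta_nat b)),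
    is_cond_exp P G (mx_coord i j k \o W) (mx_coord i j k \o Z).

Definition has_law (d d' : measure_display) (T : measurableType d)
    (T' : measurableType d') (R : realType) (P : probability T R)
    (X : T -> T') (mu : set T' -> \bar R) : Prop :=
  forall B : set T', measurable B -> P (X @^-1` B) = mu B.

Definition independent_RV2 (d d' : measure_display) (T : measurableType d)
    (T' : measurableType d') (R : realType) (P : probability T R)
    (X Y : T -> T') : Prop :=
  forall A B : set T', measurable A -> measurable B ->
    P (X @^-1` A `&` Y @^-1` B) = (P (X @^-1` A) * P (Y @^-1` B))%E.

Definition mutually_independent (d d' : measure_display)
    (T : measurableType d) (T' : measurableType d') (R : realType)
    (P : probability T R) (X : nat -> T -> T') : Prop :=
  forall (J : seq nat) (B : nat -> set T'),
    uniq J -> (forall k, measurable (B k)) ->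
    P (\bigcap_(k in [set` J]) (X k @^-1` B k)) =
    (\prod_(k <- J) P (X k @^-1` B k))%E.

Definition independent_of_sequence (d d1 d2 : measure_display)
    (T : measurableType d) (T1 : measurableType d1) (T2 : measurableType d2)
    (R : realType) (P : probability T R) (N : T -> T1) (X : nat -> T -> T2) :
    Prop :=
  forall (A : set T1) (E : set T), measurable A ->
    <<s \bigcup_k sigma_of (X k) >> E ->
    P (N @^-1` A `&` E) = (P (N @^-1` A) * P E)%E.

Definition meixner_ensemble (R : realType) (b : dyson) (n : nat)
    (mu : probability (bmx R b n) R) (A B C : R) : Prop :=
  [/\ law_on_hermitian mu,
      rotation_invariant mu,
      finite_second_moments mu
    & forall (d : measure_display) (T : measurableType d)
        (P : probability T R) (X Y : {RV P >-> bmx R b n}),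
        has_law P X mu -> has_law P Y mu -> independent_RV2 P X Y ->
        let S : T -> bmx R b n := fun w => X w + Y w in
        is_cond_exp_mx P (sigma_of S)
          (fun w => (X w - Y w) *m (X w - Y w))
          (fun w => coef_of_real b A *: (S w *m S w)
                    + coef_of_real b B *: S w + (coef_of_real b C)%:M)].

(* The diagonal matrix with m ones followed by n - m zeros. *)
Definition I_mn (R : realType) (b : dyson) (n m : nat) : bmx R b n :=
  \matrix_(i, j) ((i == j) && (i < m)%N)%:R.

Definition projection_law (R : realType) (b : dyson) (n : nat)
    (haar : probability (bmx R b n) R) (m : nat) : set (bmx R b n) -> \bar R :=
  fun B => haar [set U | B (rotate U (I_mn R b n m))].

(* The parameters q_1, ..., q_n are the values at 1, ..., n of a function on
   nat, whose other values are irrelevant. *)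
Definition qsum (R : realType) (n : nat) (q : nat -> R) : R :=
  \sum_(1 <= k < n.+1) q k.

Definition bernoulli_ensemble (R : realType) (b : dyson) (n : nat)
    (haar : probability (bmx R b n) R) (q : nat -> R) :
    set (bmx R b n) -> \bar R :=
  fun B => ((1 - qsum n q)%:E * \d_(0%R : bmx R b n) B
            + \sum_(1 <= m < n) (q m)%:E * projection_law haar m B
            + (q n)%:E * \d_((1%:M)%R : bmx R b n) B)%E.

Definition Gamma (R : realType) (x : R) : R :=
  \int[lebesgue_measure]_(t in `]0, +oo[) (t `^ (x - 1) * expR (- t)).

(* The i.i.d. sequence is indexed from 0, so that the sum of its first N terms
   ranges over the indices k < N. *)
Definition is_negative_binomial_ensemble (R : realType) (b : dyson) (n : nat)
    (haar : probability (bmx R b n) R) (r : R) (q : nat -> R)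
    (nu : probability (bmx R b n) R) : Prop :=
  let p := 1 - qsum n q in
  exists (d : measure_display) (T : measurableType d) (P : probability T R)
    (N : {RV P >-> nat}) (X : nat -> {RV P >-> bmx R b n}),
  [/\ forall j : nat, P (N @^-1` [set j]) =
        (Gamma (r + j%:R) / (Gamma r * (j`!)%:R) * p `^ r * (1 - p) ^+ j)%:E,
      forall k : nat,
        has_law P (X k) (bernoulli_ensemble haar (fun m => q m / (1 - p))),
      mutually_independent P X,
      independent_of_sequence P N X
    & has_law P (fun w => \sum_(k < N w) X k w) nu].

(* Main.v *)
(** Let X and Y be independent with law NB(r, q) and S = X + Y. Writing each of
    them as a random sum of i.i.d. random projections Z_0, Z_1, ..., the pair
    (X, Y) has the law of (Z_0 + ... + Z_(j-1), Z_j + ... + Z_(m-1)), where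
    (j, m - j) is a pair of independent negative binomial variables independent
    of the sequence. Fix m. Then S = Z_0 + ... + Z_(m-1) is symmetric in the Z_a,
    so by exchangeability E(Z_a Z_c | S) does not depend on a <> c, while
    Z_a^2 = Z_a. With signs e_a = 1 for a < j and e_a = -1 for j <= a,
    (X - Y)^2 is the sum of the e_a e_c Z_a Z_c, hence
      E((X - Y)^2 | S) - A S^2 - B S  is proportional to
      (2 j - m)^2 - m - A m (m - 1)
    as soon as A + B = 1. For A = 1 / (2 r + 1) this quantity has mean zero for
    the negative binomial weights of the pairs (j, m - j), by a telescoping
    identity that rests on the recurrence of the weights, i.e. on
    Gamma(x + 1) = x Gamma(x). *)
From HB Require Import structures.
Require Import Defs.
From mathcomp Require Import all_boot all_order all_fingroup all_algebra.
From mathcomp Require Import ring lra complex.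
From mathcomp Require Import all_classical all_reals all_analysis.
From mathcomp Require Import measurable_realfun.

Set Implicit Arguments.
Unset Strict Implicit.
Unset Printing Implicit Defensive.

Import Order.TTheory GRing.Theory Num.Theory.
Import numFieldNormedType.Exports.
Local Open Scope classical_set_scope.
Local Open Scope ring_scope.

(** * The Gamma recurrence *)

(** The two independent variables live on an arbitrary probability space, unrelated to the one that
    carries [N] and the sequence, so the pair (X, Y) is reached only through its law. That law is
    identified on rectangles: the Cauchy product of two series, summed along antidiagonals, matches
    the product of the two compound laws. Conditional expectations are tested, never constructed: an
    event of sigma(S) is {S in D}, and the indicator of D at S is symmetric in the Z_a, so it stays
    inside every integral. The condition A + B = 1 removes the diagonal: Z_a^2 = Z_a occurs with
    coefficient e_a^2 - A - B = 0, and the off-diagonal terms share one integral. The transfer of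
    laws is stated for nonnegative integrands, whereas the regression defect changes sign. Its
    positive and negative parts are therefore compared for each fixed m, where they differ by a
    finite sum that vanishes. *)

Section GammaRecurrence.
Variable R : realType.
Implicit Types x t : R.

Lemma continuous_powR_gt0 x t : 0 < t -> {for t, continuous (fun s => s `^ x)}.
Proof.
move=> t0; apply: differentiable_continuous; apply/derivable1_diffP.
by apply: derivable_powR; rewrite in_itv/= t0.
Qed.

(** Integration by parts with the antiderivative [- expR (- t)], on a segment away from 0, where the
    power is differentiable. *)
Lemma Gamma_by_parts x (a b : R) : 0 < a -> a < b ->
  (\int[lebesgue_measure]_(t in `[a, b]) (t `^ x * expR (- t))%:E =
   (a `^ x * expR (- a) - b `^ x * expR (- b))%:E +
   x%:E * \int[lebesgue_measure]_(t in `[a, b]) (t `^ (x - 1) * expR (- t))%:E)%E.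
Proof.
move=> a0 ab.
have pos t : t \in `[a, b] -> 0 < t.
  by rewrite in_itv/= => /andP[/(lt_le_trans a0)].
have cexpN t : {for t, continuous (fun s : R => expR (- s))}.
  by apply: continuous_comp; [exact: opp_continuous|exact: continuous_expR].
have cw (f : R -> R) : (forall t, 0 < t -> {for t, continuous f}) ->
    {within `[a, b], continuous f}.
  move=> cf; apply: continuous_in_subspaceT => t; rewrite inE/= => tab.
  exact/cf/pos.
have dexpN t : is_derive t 1 (fun s : R => - expR (- s)) (expR (- t)).
  by apply: is_derive_eq => /=; rewrite mulrN1 opprK.
rewrite (@integration_by_parts R (fun t => t `^ x) (fun t => - expR (- t))
  (fun t => x * t `^ (x - 1)) (fun t => expR (- t)))//; last 6 first.
- apply: cw => t t0; apply: continuousM; first exact: cst_continuous.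
  exact: continuous_powR_gt0.
- split.
  + move=> t tab; apply: derivable_powR; rewrite in_itv/= andbT.
    by apply: pos; exact: subset_itv_oo_cc tab.
  + by apply: cvg_at_right_filter; exact: continuous_powR_gt0.
  + apply: cvg_at_left_filter; apply: continuous_powR_gt0.
    exact: lt_trans ab.
- move=> t tab; rewrite powR_derive1// in_itv/= andbT.
  by apply: pos; exact: subset_itv_oo_cc tab.
- by apply: cw => t _; exact: cexpN.
- split.
  + by move=> t _; have [] := dexpN t.
  + by apply: cvg_at_right_filter; apply: cvgN; exact: cexpN.
  + by apply: cvg_at_left_filter; apply: cvgN; exact: cexpN.
- by move=> t _; rewrite derive1E; have [_ ->] := dexpN t.
congr (_ + _)%E; first by congr EFin; ring.
have intf : lebesgue_measure.-integrable `[a, b]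
    (fun t => (t `^ (x - 1) * expR (- t))%:E).
  apply: continuous_compact_integrable; first exact: segment_compact.
  apply: cw => t t0; apply: continuousM; last exact: cexpN.
  exact: continuous_powR_gt0.
transitivity (- ((- x)%:E * \int[lebesgue_measure]_(t in `[a, b])
    (t `^ (x - 1) * expR (- t))%:E))%E; last by rewrite EFinN mulNe oppeK.
rewrite -integralZl//; congr (- _)%E; apply: eq_integral => t _.
by rewrite -EFinM; congr EFin; ring.
Qed.

Lemma expR_ge_expn k t : 0 <= t -> t ^+ k <= k`!%:R * expR t.
Proof.
move=> t0; case: k => [|k]; first by rewrite expr0 fact0 mul1r -expR0 ler_expR.
have := expR_ge1Dxn k t0; rewrite -ler_pdivrMl ?ltr0n ?fact_gt0//.
by apply: le_trans; rewrite mulrC lerDr.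
Qed.

(** With k > x an integer and t = n + 2, t^x e^(-t) <= t^k e^(-t) <= (k+1)! / (n+1): the term of
    order k+1 of the exponential series leaves one power of t to spare. *)
Lemma powR_expRN_cvg0 x : 0 < x ->
  (n.+2%:R : R) `^ x * expR (- n.+2%:R) @[n --> \oo] --> 0.
Proof.
move=> x0; pose k := Num.bound x.
apply: (@squeeze_cvgr _ _ _ _ (cst 0) (fun n => k.+1`!%:R * harmonic n)).
- near=> n; rewrite /cst mulr_ge0 ?powR_ge0 ?expR_ge0//=.
  have n1 : 1 <= n.+2%:R :> R by rewrite ler1n.
  have n0 : 0 <= n.+2%:R :> R by [].
  apply: (@le_trans _ _ (n.+2%:R ^+ k * expR (- n.+2%:R))).
    rewrite ler_pM2r ?expR_gt0// -powR_mulrn// ler_powR//.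
    exact/ltW/archi_boundP/ltW.
  rewrite expRN ler_pdivrMr ?expR_gt0//.
  rewrite mulrAC ler_pdivlMr ?ltr0n//.
  apply: le_trans (expR_ge_expn k.+1 n0).
  by rewrite exprSr ler_wpM2l ?exprn_ge0// ler_nat.
- exact: cvg_cst.
- by rewrite -[X in _ --> X](mulr0 k.+1`!%:R); apply: cvgMr; exact: cvg_harmonic.
Unshelve. all: by end_near. Qed.

Lemma powR_invn_cvg0 x : 0 < x ->
  (n.+2%:R^-1 : R) `^ x * expR (- n.+2%:R^-1) @[n --> \oo] --> 0.
Proof.
move=> x0; have /cvg_at_rightP/(_ (fun n => n.+2%:R^-1)) cp := powR_cvg0 x0.
apply: (@squeeze_cvgr _ _ _ _ (cst 0) (fun n => (n.+2%:R^-1 : R) `^ x)).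
- near=> n; rewrite /cst mulr_ge0 ?powR_ge0 ?expR_ge0//=.
  by rewrite ler_piMr ?powR_ge0// expRN invf_le1 ?expR_gt0// -expR0 ler_expR.
- exact: cvg_cst.
- apply: cp; split=> [n|]; first by rewrite invr_gt0.
  have := @cvg_harmonic R; rewrite -(@cvg_shiftS _ (@harmonic R)).
  by apply: cvg_trans; apply: near_eq_cvg; near=> n.
Unshelve. all: by end_near. Qed.

(** [Gamma] is the [fine] of an extended integral. For infinite [y] both sides are 0, so an identity
    between extended integrals passes directly to [Gamma]. *)
Lemma fine_gt0M x (y : \bar R) : 0 < x -> fine (x%:E * y) = x * fine y.
Proof.
by move=> x0; case: y => [y||]; rewrite ?gt0_muley ?gt0_muleNy ?lte_fin//= mulr0.
Qed.

Lemma GammaD1 x : 0 < x -> Gamma (x + 1) = x * Gamma x.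
Proof.
move=> x0; rewrite /Gamma /Rintegral addrK.
(* The offset 2 gives 1/(n+2) < 1 < n+2 already for n = 0, since [Gamma_by_parts] wants a
   nondegenerate segment. *)
pose F n := [set` `[(n.+2%:R^-1 : R), n.+2%:R]].
have bigF : \bigcup_n F n = [set` `]0%R, +oo[].
  apply/seteqP; split=> [t [n _]|t]; rewrite /F /= !in_itv/= ?andbT.
    by case/andP => + _; apply: lt_le_trans; rewrite invr_gt0.
  move=> t0; pose m := (Num.bound t + Num.bound t^-1)%N.
  have le1 : t <= m.+2%:R.
    apply: le_trans (ltW (archi_boundP (ltW t0))) _.
    by rewrite ler_nat /m -addnS -addnS leq_addr.
  have le2 : t^-1 <= m.+2%:R.
    apply: le_trans (ltW (archi_boundP _)) _; first by rewrite invr_ge0 ltW.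
    by rewrite ler_nat /m -addSn -addSn leq_addl.
  exists m => //; rewrite /F/= in_itv/= le1 andbT.
  by rewrite -[leRHS]invrK lef_pV2// ?posrE ?invr_gt0// ltr0n.
have ndF : nondecreasing_seq F.
  apply/nondecreasing_seqP => n; apply/subsetPset => t; rewrite /F/= !in_itv/=.
  case/andP => a1 b1; apply/andP; split.
    by apply: le_trans a1; rewrite lef_pV2 ?posrE// ler_nat.
  by apply: le_trans b1 _; rewrite ler_nat.
have mf y n : measurable_fun (F n) (fun t => (t `^ y * expR (- t))%:E).
  apply/measurable_EFinP; apply: measurable_funTS.
  apply: measurable_funM; first exact: measurable_powR.
  by apply: measurableT_comp => //; exact: measurable_funN.
have cvF y : (\int[lebesgue_measure]_(t in F n) (t `^ y * expR (- t))%:E @[n --> \oo]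
    --> \int[lebesgue_measure]_(t in `]0%R, +oo[) (t `^ y * expR (- t))%:E)%E.
  rewrite -bigF.
  have mF n : measurable (F n) by exact: measurable_itv.
  have f0 n t : F n t -> (0 <= (t `^ y * expR (- t))%:E)%E.
    by move=> _; rewrite lee_fin mulr_ge0 ?powR_ge0 ?expR_ge0.
  exact: (@ge0_nondecreasing_set_cvg_integral _ (measurableTypeR R) R F _
    (lebesgue_measure : {measure set _ -> \bar R}) ndF mF (mf y) f0).
pose I (y : R) : \bar R :=
  (\int[lebesgue_measure]_(t in `]0%R, +oo[) (t `^ y * expR (- t))%:E)%E.
pose IF (y : R) n : \bar R :=
  (\int[lebesgue_measure]_(t in F n) (t `^ y * expR (- t))%:E)%E.
pose u n : R := (n.+2%:R^-1) `^ x * expR (- n.+2%:R^-1) -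
  n.+2%:R `^ x * expR (- n.+2%:R).
have u0 : (u n)%:E @[n --> \oo] --> 0%:E.
  apply: cvg_EFin; first by near=> n.
  rewrite -[X in _ --> X]subr0; apply: cvgB; first exact: powR_invn_cvg0.
  exact: powR_expRN_cvg0.
have IE n : IF x n = ((u n)%:E + x%:E * IF (x - 1)%R n)%E.
  apply: Gamma_by_parts; rewrite ?invr_gt0//.
  by rewrite (@lt_trans _ _ 1)// ?invf_lt1// ltr1n.
have cvI y : IF y n @[n --> \oo] --> I y := cvF y.
rewrite -/(I x) -/(I (x - 1)).
clearbody I IF u; clear F bigF ndF mf cvF.
suff -> : I x = (x%:E * I (x - 1)%R)%E.
  exact: fine_gt0M.
have cJ : IF x n @[n --> \oo] --> (0%:E + x%:E * I (x - 1)%R)%E.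
  under eq_cvg do rewrite IE.
  by apply: cvgeD => //; exact: cvgeZl.
by rewrite add0e in cJ; apply: cvg_unique (cvI x) cJ.
Unshelve. all: by end_near. Qed.

End GammaRecurrence.

(** * Negative binomial weights *)

Section NegativeBinomialWeights.
Variables (R : realType) (r c : R) (a : nat -> R).
Hypotheses (r_gt0 : 0 < r) (c_gt0 : 0 < c) (c_lt1 : c < 1).
Hypothesis a_ge0 : forall j, 0 <= a j.
Hypothesis a_rec : forall j, j.+1%:R * a j.+1 = c * (r + j%:R) * a j.

(* The summand is the increment of
   [j (r + m - j) (2 j - m - 1) a_j a_(m-j)], up to the factor [- 2 / (2 r + 1)]. *)
Lemma convolution_weights_variance (m : nat) :
  \sum_(j < m.+1) a j * a (m - j)%N *
    ((2 * j%:R - m%:R) ^+ 2 - m%:R - 1 / (2 * r + 1) * (m%:R * (m%:R - 1))) = 0.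
Proof.
(* The guard makes [G m.+1] vanish. There [m - m.+1] truncates to 0 and the bare formula would give
   (m+1)^2 (r-1) a_(m+1) a_0. *)
pose G (j : nat) := if (j <= m)%N then j%:R * (r + m%:R - j%:R) *
  (2 * j%:R - m%:R - 1) * (a j * a (m - j)%N) else 0.
have r1 : 2 * r + 1 != 0 by rewrite gt_eqF// addr_gt0// mulr_gt0.
(* After multiplication by c, the recurrence is used twice: at j to lower the index j+1, and at
   m-j-1 to raise the other index to m-j. *)
have step (j : nat) : (j < m)%N ->
    j.+1%:R * (r + m%:R - j.+1%:R) * (a j.+1 * a (m - j.+1)%N) =
    (r + j%:R) * (m%:R - j%:R) * (a j * a (m - j)%N).
  move=> jm; apply: (mulfI (lt0r_neq0 c_gt0)).
  have := a_rec (m - j.+1)%N; rewrite -subSn// subSS => e2.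
  have -> : m%:R = (m - j)%:R + j%:R :> R by rewrite -natrD subnK// ltnW.
  have E : (m - j)%:R = (m - j.+1)%:R + 1 :> R.
    by rewrite -[in LHS]subSS subSn// -addn1 natrD.
  have e1 : (j%:R + 1) * a j.+1 = c * (r + j%:R) * a j by rewrite -a_rec -natr1.
  rewrite -natr1.
  transitivity ((c * (r + (m - j.+1)%:R) * a (m - j.+1)%N) * ((j%:R + 1) * a j.+1)).
    by rewrite E; ring.
  by rewrite e1 -e2; ring.
have GS (j : nat) : (j <= m)%N -> G j.+1 - G j = - (2 * r + 1) / 2 *
    (a j * a (m - j)%N *
    ((2 * j%:R - m%:R) ^+ 2 - m%:R - 1 / (2 * r + 1) * (m%:R * (m%:R - 1)))).
  move=> jm; have -> : G j.+1 = (2 * j%:R + 1 - m%:R) *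
      ((r + j%:R) * (m%:R - j%:R) * (a j * a (m - j)%N)).
    move: jm; rewrite leq_eqVlt => /predU1P[->|jm].
      by rewrite /G ltnn subrr mulr0 mul0r mulr0.
    rewrite -step// /G jm -natr1; ring.
  by rewrite /G jm; field.
apply: (@mulfI _ (- (2 * r + 1) / 2)).
  by rewrite mulf_neq0// oppr_eq0.
rewrite mulr0 mulr_sumr.
under eq_bigr => j _ do rewrite -GS ?leq_ord//.
rewrite -(big_mkord xpredT (fun j => G j.+1 - G j)) telescope_sumr//.
by rewrite /G ltnn leq0n !mul0r subrr.
Qed.

Hypothesis a_sum : forall n, \sum_(j < n) a j <= 1.

(** By the recurrence, the partial sums S_n of j a_j, and then of j^2 a_j, satisfy S_(n+1) <= d + c
    S_n with c < 1. By induction they stay below the fixed point d / (1 - c). The bound on the first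
    moments enters the d of the second ones. *)
Lemma weights_second_moment_bound :
  exists K, forall n, \sum_(j < n) j%:R ^+ 2 * a j <= K.
Proof.
have c1 : 0 < 1 - c by rewrite subr_gt0.
have bound (u : nat -> R) (d : R) : (forall j, 0 <= u j) -> 0 <= d -> (forall n,
    \sum_(j < n.+1) u j <= d + c * \sum_(j < n) u j) ->
    forall n, \sum_(j < n) u j <= d / (1 - c).
  move=> u0 d0 H; elim=> [|n IH]; first by rewrite big_ord0 divr_ge0// ltW.
  apply: le_trans (H n) _.
  have -> : d / (1 - c) = d + c * (d / (1 - c)) by field; rewrite lt0r_neq0.
  by rewrite lerD2l ler_pM2l.
have M1 : forall n, \sum_(j < n) j%:R * a j <= c * r / (1 - c).
  apply: (bound (fun j => j%:R * a j)) => [j||n]; rewrite ?mulr_ge0 ?(ltW c_gt0) ?(ltW r_gt0)//.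
  rewrite big_ord_recl mul0r add0r.
  have E j : j.+1%:R * a j.+1 = c * r * a j + c * (j%:R * a j).
    by rewrite a_rec; ring.
  under eq_bigr => j _ do rewrite E.
  rewrite big_split/= -!mulr_sumr lerD2r.
  by rewrite ler_piMr ?a_sum ?mulr_ge0 ?(ltW c_gt0) ?(ltW r_gt0).
exists ((c * r + c * (r + 1) * (c * r / (1 - c))) / (1 - c)).
apply: (bound (fun j => j%:R ^+ 2 * a j)) => [j||n].
- by rewrite mulr_ge0// exprn_ge0.
- have [c0 r0] := (ltW c_gt0, ltW r_gt0).
  by rewrite addr_ge0 ?mulr_ge0 ?invr_ge0 ?(ltW c1)// addr_ge0.
rewrite big_ord_recl expr0n mul0r add0r.
have E j : j.+1%:R ^+ 2 * a j.+1 =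
    c * r * a j + c * (r + 1) * (j%:R * a j) + c * (j%:R ^+ 2 * a j).
  by rewrite expr2 -mulrA a_rec -natr1; ring.
under eq_bigr => j _ do rewrite E.
rewrite !big_split/= -!mulr_sumr lerD2r lerD//.
- by rewrite ler_piMr ?a_sum ?mulr_ge0 ?(ltW c_gt0) ?(ltW r_gt0).
- by rewrite ler_pM2l ?M1// mulr_gt0 ?addr_gt0.
Qed.

End NegativeBinomialWeights.

(** The triangle j <= m is padded with zeros to a full quadrant, where nonnegative sums may be
    interchanged. Finiteness of the sum of [g] allows it to be factored out as a real scalar. *)
Lemma nneseries_cauchy_product (R : realType) (f g : nat -> R) :
  (forall i, 0 <= f i) -> (forall i, 0 <= g i) ->
  (\sum_(k <oo) (g k)%:E < +oo)%E ->
  (\sum_(m <oo) \sum_(j < m.+1) (f j * g (m - j)%N)%:E =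
   (\sum_(j <oo) (f j)%:E) * \sum_(k <oo) (g k)%:E)%E.
Proof.
move=> f0 g0 goo.
have fg0 i j : (0 <= (f i * g j)%:E)%E by rewrite lee_fin mulr_ge0.
transitivity (\sum_(m <oo) \sum_(j <oo)
    if (j <= m)%N then (f j * g (m - j)%N)%:E else 0)%E.
  apply: eq_eseriesr => m _.
  rewrite (nneseries_split 0 m.+1)//=; last by move=> k _; case: ifP.
  rewrite add0n [X in (_ + X)%E]eseries0 ?adde0; last first.
    by move=> k mk _; rewrite leqNgt mk.
  by rewrite big_mkord; apply: eq_bigr => j _; rewrite leq_ord.
rewrite nneseries_interchange; last by move=> m j; case: ifP.
have gfin : (\sum_(k <oo) (g k)%:E \is a fin_num)%E.
  by rewrite ge0_fin_numE// nneseries_ge0// => k _ _; rewrite lee_fin.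
rewrite muleC -(fineK gfin) -nneseriesZl; last by move=> i _; rewrite lee_fin.
apply: eq_eseriesr => j _; rewrite (fineK gfin) muleC.
rewrite -nneseriesZl; last by move=> i _; rewrite lee_fin.
rewrite (nneseries_split 0 j)//=; last by move=> k _; case: ifP.
rewrite big1_seq ?add0e; last first.
  move=> i /=; rewrite mem_index_iota leq0n/= => ij.
  by rewrite leqNgt ij.
rewrite add0n.
apply/cvg_lim => //; rewrite -(@cvg_shiftn j).
apply: (@cvg_trans _ (\sum_(0 <= i < n) ((f j)%:E * (g i)%:E) @[n --> \oo])%E).
  apply: near_eq_cvg; near=> n => /=.
  rewrite -[X in _ = \sum_(X <= _ < _) _]add0n big_addn addnK.
  by apply: eq_bigr => i _; rewrite leq_addl addnK.
by apply: is_cvg_nneseries => i _ _; rewrite -EFinM.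
Unshelve. all: by end_near. Qed.

(** * Matrices over the coefficient rings *)

Section CoefficientCoordinates.
Variables (R : realType) (b : dyson).
Implicit Types x y : coef R b.

Definition coef_coordk (k : 'I_(beta_nat b)) x : R := tnth (coef_coord x) k.

Lemma coef_coordkD k x y : coef_coordk k (x + y) = coef_coordk k x + coef_coordk k y.
Proof.
rewrite /coef_coordk; case: b k x y => /=.
- by case=> [[]].
- by case=> [[|[]]]// ? [? ?] [? ?].
- by case=> [[|[|[|[]]]]].
Qed.

Lemma coef_coordkN k x : coef_coordk k (- x) = - coef_coordk k x.
Proof.
rewrite /coef_coordk; case: b k x => /=.
- by case=> [[]].
- by case=> [[|[]]]// ? [? ?].
- by case=> [[|[|[|[]]]]].
Qed.

Lemma coef_coordkZ k (a : R) x :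
  coef_coordk k (coef_of_real b a * x) = a * coef_coordk k x.
Proof.
rewrite /coef_coordk; case: b k x => /=.
- by case=> [[]].
- by case=> [[|[]]]// ? [? ?]; rewrite /tnth/=; simpc; rewrite ?mul0r ?subr0 ?addr0.
- by case=> [[|[|[|[]]]]]// ? [? ? ? ?]; rewrite /tnth/= !mul0r ?subr0 ?addr0.
Qed.

Lemma coef_coordk_inj x y : (forall k, coef_coordk k x = coef_coordk k y) -> x = y.
Proof.
move=> e; have {e} : coef_coord x = coef_coord y by apply: eq_from_tnth.
case: b x y => /= [x y|[? ?] [? ?]|[? ? ? ?] [? ? ? ?]] => /(congr1 val)[];
  by move=> *; subst.
Qed.

(** The [g k p q] are the structure constants of the real algebra in its standard basis. Products of
    basis elements are basis elements up to sign, whence the bound by 1. With this formula, products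
    are treated uniformly in beta. *)
Lemma coef_coordkM : exists2 g : forall k p q : 'I_(beta_nat b), R,
  (forall k p q, `|g k p q| <= 1) &
  forall k x y, coef_coordk k (x * y) =
    \sum_p \sum_q g k p q * (coef_coordk p x * coef_coordk q y).
Proof.
pose e : forall b, 'I_(beta_nat b) -> coef R b := fun b => match b with
  | beta1 => fun=> 1
  | beta2 => fun p => if (p == 0%N :> nat) then (Complex 1 0) else (Complex 0 1)
  | beta4 => fun p => [:: Quat 1 0 0 0; Quat 0 1 0 0; Quat 0 0 1 0; Quat 0 0 0 1]`_p
  end.
exists (fun k p q => coef_coordk k (e b p * e b q)).
- rewrite /coef_coordk; case: b => /=.
  + by case=> [[]]//= ? ? ?; rewrite /tnth/= mulr1 normr1.
  + by case=> [[|[]]]//= ? [[|[]]]//= ? [[|[]]]//= ?; rewrite /tnth/=; simpc;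
    rewrite ?mulr1 ?mulr0 ?mul0r ?subr0 ?sub0r ?addr0 ?add0r ?normrN ?normr1 ?normr0.
  + by case=> [[|[|[|[]]]]]//= ? [[|[|[|[]]]]]//= ? [[|[|[|[]]]]]//= ?; rewrite /tnth/=;
    rewrite ?mulr1 ?mulr0 ?mul0r ?subr0 ?sub0r ?addr0 ?add0r ?oppr0 ?normrN ?normr1 ?normr0.
- rewrite /coef_coordk; case: b => /=.
  + by case=> [[]]//= ? ? ?; rewrite !big_ord1 /tnth/= mulr1 mul1r.
  + case=> [[|[]]]//= ? [? ?] [? ?]; rewrite !big_ord_recl !big_ord0 /tnth/=; simpc;
    ring.
  + case=> [[|[|[|[]]]]]//= ? [? ? ? ?] [? ? ? ?]; rewrite !big_ord_recl !big_ord0 /tnth/=;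
    ring.
Qed.

Lemma coef_conjD x y : coef_conj (x + y) = coef_conj x + coef_conj y.
Proof.
case: b x y => //= [[? ?] [? ?]|x y]; first by congr Complex; rewrite /= ?opprD.
by congr Quat; rewrite /= ?opprD.
Qed.

Lemma coef_conjM x y : coef_conj (x * y) = coef_conj y * coef_conj x.
Proof.
case: b x y => /= [x y|[? ?] [? ?]|x y]; first exact: mulrC.
  by simpc; congr Complex; ring.
by congr Quat => /=; ring.
Qed.

Lemma coef_conj0 : coef_conj (0 : coef R b) = 0.
Proof. by case: b => //=; [rewrite /= oppr0|congr Quat; rewrite /= oppr0]. Qed.

Lemma coef_conj1 : coef_conj (1 : coef R b) = 1.
Proof. by case: b => //=; [rewrite /= oppr0|congr Quat; rewrite /= oppr0]. Qed.

Lemma coef_conjK x : coef_conj (coef_conj x) = x.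
Proof. by case: b x => //= [[? ?]|[? ? ? ?]] /=; rewrite ?opprK. Qed.

Lemma coef_coordk_conj k x :
  coef_coordk k (coef_conj x) = (-1) ^+ (k != 0%N :> nat) * coef_coordk k x.
Proof.
rewrite /coef_coordk; case: b k x => /=.
- by case=> [[]]//= ? x; rewrite mul1r.
- by case=> [[|[]]]// ? [? ?]; rewrite /tnth/= ?mul1r ?mulN1r.
- by case=> [[|[|[|[]]]]]// ? [? ? ? ?]; rewrite /tnth/= ?mul1r ?mulN1r.
Qed.

Lemma beta_nat_gt0 : (0 < beta_nat b)%N. Proof. by case: b. Qed.

Lemma coef_coord0_mul_conj x : coef_coordk (Ordinal beta_nat_gt0) (x * coef_conj x) =
  \sum_k coef_coordk k x ^+ 2.
Proof.
rewrite /coef_coordk; case: b x beta_nat_gt0 => /=.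
- by move=> x ?; rewrite big_ord1 /tnth/= expr2.
- by move=> [? ?] ?; rewrite !big_ord_recl big_ord0 /tnth/=; simpc; ring.
- by move=> [? ? ? ?] ?; rewrite !big_ord_recl big_ord0 /tnth/=; ring.
Qed.

End CoefficientCoordinates.

Section MatrixCoordinates.
Variables (R : realType) (b : dyson) (n : nat).
Implicit Types M N U V : bmx R b n.

Lemma mx_coordE i j k M : mx_coord i j k M = coef_coordk k (M i j).
Proof. by []. Qed.

Lemma mx_coordD i j k M N : mx_coord i j k (M + N) = mx_coord i j k M + mx_coord i j k N.
Proof. by rewrite !mx_coordE mxE coef_coordkD. Qed.

Lemma mx_coordN i j k M : mx_coord i j k (- M) = - mx_coord i j k M.
Proof. by rewrite !mx_coordE mxE coef_coordkN. Qed.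

Lemma mx_coordB i j k M N : mx_coord i j k (M - N) = mx_coord i j k M - mx_coord i j k N.
Proof. by rewrite mx_coordD mx_coordN. Qed.

Lemma mx_coord0 i j k : mx_coord i j k (0 : bmx R b n) = 0.
Proof. by rewrite -(subrr (0 : bmx R b n)) mx_coordB subrr. Qed.

Lemma mx_coord_sum i j k I (s : seq I) (P : pred I) (F : I -> bmx R b n) :
  mx_coord i j k (\sum_(a <- s | P a) F a) = \sum_(a <- s | P a) mx_coord i j k (F a).
Proof. exact: (big_morph _ (mx_coordD i j k) (mx_coord0 i j k)). Qed.

Lemma mx_coordZ i j k (a : R) M :
  mx_coord i j k (coef_of_real b a *: M : bmx R b n) = a * mx_coord i j k M.
Proof. by rewrite !mx_coordE mxE coef_coordkZ. Qed.

Lemma mx_coord_inj M N : (forall i j k, mx_coord i j k M = mx_coord i j k N) -> M = N.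
Proof. by move=> e; apply/matrixP => i j; apply: coef_coordk_inj => k; exact: e. Qed.

Lemma coef_coordk0 k : coef_coordk k (0 : coef R b) = 0.
Proof. by apply: (addrI (coef_coordk k 0)); rewrite -coef_coordkD !addr0. Qed.

Lemma mx_coordM : exists2 g : forall k p q : 'I_(beta_nat b), R,
  (forall k p q, `|g k p q| <= 1) &
  forall i j k M N, mx_coord i j k (M *m N : bmx R b n) =
    \sum_l \sum_p \sum_q g k p q * (mx_coord i l p M * mx_coord l j q N).
Proof.
have [g g1 gE] := coef_coordkM R b; exists g => // i j k M N.
rewrite mx_coordE mxE.
rewrite (big_morph _ (@coef_coordkD R b k) (coef_coordk0 k)).
by apply: eq_bigr => l _; rewrite gE.
Qed.

Lemma mx_adjM M N : mx_adj (M *m N : bmx R b n) = mx_adj N *m mx_adj M.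
Proof.
apply/matrixP => i j; rewrite !mxE.
have /= -> := big_morph _ (@coef_conjD R b) (@coef_conj0 R b).
by apply: eq_bigr => l _; rewrite !mxE coef_conjM.
Qed.

Lemma mx_adjD M N : mx_adj (M + N) = mx_adj M + mx_adj N.
Proof. by apply/matrixP => i j; rewrite !mxE coef_conjD. Qed.

Lemma mx_adjK M : mx_adj (mx_adj M) = M.
Proof. by apply/matrixP => i j; rewrite !mxE coef_conjK. Qed.

Lemma mx_adj0 : mx_adj (0 : bmx R b n) = 0.
Proof. by apply/matrixP => i j; rewrite !mxE coef_conj0. Qed.

Lemma mx_adj_bool (f : 'I_n -> 'I_n -> bool) : (forall i j, f i j = f j i) ->
  mx_adj (\matrix_(i, j) (f i j)%:R : bmx R b n) = \matrix_(i, j) (f i j)%:R.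
Proof.
move=> fC; apply/matrixP => i j; rewrite !mxE fC.
by case: (f i j); [exact: coef_conj1|exact: coef_conj0].
Qed.

Lemma mx_adj1 : mx_adj (1%:M : bmx R b n) = 1%:M.
Proof.
have -> : (1%:M : bmx R b n) = \matrix_(i, j) (i == j)%:R.
  by apply/matrixP => i j; rewrite !mxE.
by apply: mx_adj_bool => i j; rewrite eq_sym.
Qed.

Definition projections : set (bmx R b n) := [set M | mx_adj M = M /\ M *m M = M].

(** Since M = M M^*, the real part of M_ii is the sum of the |M_il|^2. It dominates its own square,
    hence is at most 1, and it dominates the square of every coordinate in row i. *)
Lemma projections_coord_le1 M i j k : projections M -> `|mx_coord i j k M| <= 1.
Proof.
case=> Mh MM; pose k0 := Ordinal (beta_nat_gt0 b).
have E : mx_coord i i k0 M = \sum_l \sum_p mx_coord i l p M ^+ 2.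
  rewrite {1}mx_coordE -{1}MM mxE.
  rewrite (big_morph _ (@coef_coordkD R b k0) (coef_coordk0 k0)).
  apply: eq_bigr => l _; rewrite -{2}Mh !mxE.
  exact: coef_coord0_mul_conj.
have le l p : mx_coord i l p M ^+ 2 <= mx_coord i i k0 M.
  rewrite E (bigD1 l)//= (bigD1 p)//= -addrA lerDl addr_ge0//.
    by apply: sumr_ge0 => *; exact: sqr_ge0.
  by apply: sumr_ge0 => ? _; apply: sumr_ge0 => *; exact: sqr_ge0.
have h1 : mx_coord i i k0 M <= 1.
  have := le i k0; set u := mx_coord _ _ _ _ => uu.
  rewrite leNgt; apply/negP => u1; move: uu; rewrite leNgt => /negP; apply.
  by rewrite expr2 ltr_pMr// (lt_trans ltr01).
by rewrite -(@expr_le1 _ 2)// real_normK ?num_real// (le_trans (le j k)).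
Qed.

Lemma rotateM U V M : rotate (U *m V : bmx R b n) M = rotate U (rotate V M).
Proof. by rewrite /rotate mx_adjM !mulmxA. Qed.

Lemma rotateD U M N : rotate U (M + N) = rotate U M + rotate U N.
Proof. by rewrite /rotate mulmxDr mulmxDl. Qed.

Lemma rotate0 U : rotate U 0 = 0.
Proof. by rewrite /rotate mulmx0 mul0mx. Qed.

Lemma rotate1 U : unitary_group U -> rotate U (1%:M) = 1%:M.
Proof. by case=> U1 _; rewrite /rotate mulmx1. Qed.

Lemma rotate_sum U I (s : seq I) (P : pred I) (F : I -> bmx R b n) :
  rotate U (\sum_(a <- s | P a) F a) = \sum_(a <- s | P a) rotate U (F a).
Proof. exact: (big_morph _ (rotateD U) (rotate0 U)). Qed.

Lemma projections_rotate U M : unitary_group U ->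
  projections M -> projections (rotate U M).
Proof.
move=> [_ U2] [Mh MM]; split; rewrite /rotate.
  by rewrite !mx_adjM mx_adjK Mh mulmxA.
by rewrite -!mulmxA (mulmxA (mx_adj U)) U2 mul1mx (mulmxA M M) MM.
Qed.

Lemma projections_I_mn m : projections (I_mn R b n m).
Proof.
split.
  apply: mx_adj_bool => i j.
  by case: eqVneq => [->|]; rewrite ?eqxx// eq_sym => /negPf ->.
apply/matrixP => i j; rewrite !mxE (bigD1 i)//= big1 => [|l li]; rewrite !mxE.
  by rewrite addr0 eqxx/=; case: (i < m)%N; rewrite ?andbF ?mul1r ?mul0r.
by rewrite eq_sym (negPf li) mul0r.
Qed.

Lemma projections0 : projections 0.
Proof. by split; rewrite ?mx_adj0 ?mul0mx. Qed.

Lemma projections1 : projections 1%:M.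
Proof. by split; rewrite ?mx_adj1 ?mul1mx. Qed.

End MatrixCoordinates.

(** * Measurability of the matrix operations, coordinate by coordinate *)

Section MatrixBorel.
Variables (R : realType) (b : dyson) (n : nat).
Context d (T : measurableType d).
Implicit Types f g : T -> bmx R b n.

Lemma measurable_mx_coord i j k : measurable_fun [set: bmx R b n] (mx_coord i j k).
Proof.
move=> _ B mB; apply: sub_sigma_algebra; exists i, j, k.
by exists B.
Qed.

Lemma measurable_fun_bmx f :
  (forall i j k, measurable_fun setT (mx_coord i j k \o f)) -> measurable_fun setT f.
Proof.
move=> mf; apply: (@measurability _ _ _ _ _ _ (@bmx_generators R b n)) => //.
move=> _ [_ [i [j [k [B mB <-]]]] <-]; rewrite setTI.
by have := mf i j k measurableT B mB; rewrite setTI.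
Qed.

Lemma measurable_mx_coord_comp i j k f :
  measurable_fun setT f -> measurable_fun setT (fun w => mx_coord i j k (f w)).
Proof. by move=> mf; apply: measurableT_comp => //; exact: measurable_mx_coord. Qed.

Lemma measurable_bmxD f g : measurable_fun setT f -> measurable_fun setT g ->
  measurable_fun setT (fun w => f w + g w).
Proof.
move=> mf mg; apply: measurable_fun_bmx => i j k.
rewrite (_ : _ \o _ = fun w => mx_coord i j k (f w) + mx_coord i j k (g w)); last first.
  by apply/funext => w /=; rewrite mx_coordD.
by apply: measurable_funD; exact: measurable_mx_coord_comp.
Qed.

Lemma measurable_bmxN f : measurable_fun setT f -> measurable_fun setT (fun w => - f w).
Proof.
move=> mf; apply: measurable_fun_bmx => i j k.
rewrite (_ : _ \o _ = fun w => - mx_coord i j k (f w)); last first.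
  by apply/funext => w /=; rewrite mx_coordN.
by apply: measurable_funN; exact: measurable_mx_coord_comp.
Qed.

Lemma measurable_bmxM f g : measurable_fun setT f -> measurable_fun setT g ->
  measurable_fun setT (fun w => f w *m g w : bmx R b n).
Proof.
have [c _ cE] := mx_coordM R b n.
move=> mf mg; apply: measurable_fun_bmx => i j k.
rewrite (_ : _ \o _ = fun w => \sum_l \sum_p \sum_q
    c k p q * (mx_coord i l p (f w) * mx_coord l j q (g w))); last first.
  by apply/funext => w /=; rewrite cE.
apply: measurable_sum => l; apply: measurable_sum => p; apply: measurable_sum => q.
apply: measurable_funM => //.
by apply: measurable_funM => //; exact: measurable_mx_coord_comp.
Qed.

Lemma measurable_bmx_adj f : measurable_fun setT f ->
  measurable_fun setT (fun w => mx_adj (f w)).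
Proof.
move=> mf; apply: measurable_fun_bmx => i j k.
rewrite (_ : _ \o _ = fun w => (-1) ^+ (k != 0%N :> nat) * mx_coord j i k (f w)).
  by apply: measurable_funM => //; exact: measurable_mx_coord_comp.
by apply/funext => w /=; rewrite !mx_coordE !mxE coef_coordk_conj.
Qed.

Lemma measurable_bmx_sum (I : Type) (s : seq I) (F : I -> T -> bmx R b n) :
  (forall i, measurable_fun setT (F i)) ->
  measurable_fun setT (fun w => \sum_(i <- s) F i w).
Proof.
move=> mF; elim: s => [|a s IH].
  by rewrite (_ : (fun w => _) = cst 0)//; apply/funext => w; rewrite big_nil.
rewrite (_ : (fun w => _) = fun w => F a w + \sum_(i <- s) F i w); last first.
  by apply/funext => w; rewrite big_cons.
exact: measurable_bmxD.
Qed.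

Lemma measurable_bmx_eq f g : measurable_fun setT f -> measurable_fun setT g ->
  measurable [set w | f w = g w].
Proof.
move=> mf mg; rewrite (_ : [set w | _] = \bigcap_(t : 'I_n * 'I_n * 'I_(beta_nat b))
    [set w | mx_coord t.1.1 t.1.2 t.2 (f w - g w) = 0]).
  apply: fin_bigcap_measurable => // -[[i j] k] _ /=.
  have /(_ measurableT [set 0]) := @measurable_mx_coord_comp i j k _
    (measurable_bmxD mf (measurable_bmxN mg)).
  by rewrite setTI; apply; exact: measurable_set1.
apply/seteqP; split=> w /=.
  by move=> fg [[i j] k] _ /=; rewrite fg subrr mx_coord0.
move=> e; apply: mx_coord_inj => i j k; apply/eqP.
by rewrite -subr_eq0 -mx_coordB; apply/eqP; exact: (e (i, j, k)).
Qed.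

End MatrixBorel.

Section MatrixBorelSets.
Variables (R : realType) (b : dyson) (n : nat).

Lemma measurable_hermitian_space : measurable (@hermitian_space R b n).
Proof. by apply: measurable_bmx_eq => //; exact: measurable_bmx_adj. Qed.

Lemma measurable_unitary_group : measurable (@unitary_group R b n).
Proof.
by apply: measurableI; apply: measurable_bmx_eq => //; apply: measurable_bmxM => //;
  exact: measurable_bmx_adj.
Qed.

Lemma measurable_projections : measurable (@projections R b n).
Proof.
apply: measurableI; first exact: measurable_hermitian_space.
by apply: measurable_bmx_eq => //; exact: measurable_bmxM.
Qed.

Lemma measurable_rotate (U : bmx R b n) : measurable_fun setT (rotate U).
Proof. by apply: measurable_bmxM => //; exact: measurable_bmxM. Qed.

Lemma measurable_rotatel (M : bmx R b n) : measurable_fun setT (fun U => rotate U M).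
Proof.
by apply: measurable_bmxM; [exact: measurable_bmxM|exact: measurable_bmx_adj].
Qed.

End MatrixBorelSets.

(** * Laws of independent sequences *)

Section SequenceLaw.
Context d (V : measurableType d).

(** A pi-system generating the product sigma-algebra: each member constrains an initial segment of
    coordinates, and length 0 gives the whole space. *)
Definition cylinders : set (set (nat -> V)) :=
  [set [set x | forall k, (k < mB.1)%N -> mB.2 k (x k)] |
    mB in [set mB : nat * (nat -> set V) | forall k, measurable (mB.2 k)]].

Definition seqspace := g_sigma_algebraType cylinders.

Lemma setI_closed_cylinders : setI_closed cylinders.
Proof.
move=> _ _ [[m A] /= mA <-] [[p B] /= mB <-].
exists (maxn m p, fun k => (if (k < m)%N then A k else setT) `&`
  (if (k < p)%N then B k else setT)) => /=.
  by move=> k; apply: measurableI; case: ifP.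
apply/seteqP; split=> x /=.
  move=> H; split=> k km; have := H k; rewrite leq_max km ?orbT => /(_ isT)[];
  by rewrite ?km.
by move=> [HA HB] k _; split; case: ifP => // kk; [exact: HA|exact: HB].
Qed.

Lemma measurable_seqspace_coord k : measurable_fun setT (fun x : seqspace => x k).
Proof.
move=> _ B mB; rewrite setTI; apply: sub_sigma_algebra.
exists (k.+1, fun l => if l == k then B else setT) => /=.
  by move=> l; case: ifP.
apply/seteqP; split=> x /=; first by move=> /(_ k (ltnSn k)); rewrite eqxx.
by move=> Bx l _; case: eqP => [->|].
Qed.

Lemma measurable_to_seqspace d' (T : measurableType d') (X : nat -> T -> V) :
  (forall k, measurable_fun setT (X k)) ->
  measurable_fun setT (fun w => X ^~ w : seqspace).
Proof.
move=> mX; apply: (@measurability _ _ T seqspace setT _ cylinders) => //.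
move=> _ [_ [[m B] /= mB <-] <-].
rewrite setTI (_ : _ @^-1` _ = \bigcap_(k in `I_m) (X k @^-1` B k))//.
apply: bigcap_measurableType => // k _; rewrite -[_ @^-1` _]setTI; exact: mX.
Qed.

(** Independence in the form seen by [cylinders], on initial segments; it is stable under the
    reindexing, mapping and concatenation used below. *)
Definition cylinder_independent (R : realType) d' (T : measurableType d')
    (P : probability T R) (X : nat -> T -> V) : Prop :=
  forall m (B : nat -> set V), (forall k, measurable (B k)) ->
  P [set w | forall k, (k < m)%N -> B k (X k w)] =
    (\prod_(k < m) P (X k @^-1` B k))%E.

Context (R : realType) d1 (T1 : measurableType d1) d2 (T2 : measurableType d2).
Variables (P1 : probability T1 R) (P2 : probability T2 R).
Variables (X1 : nat -> T1 -> V) (X2 : nat -> T2 -> V).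
Hypotheses (mX1 : forall k, measurable_fun setT (X1 k))
  (mX2 : forall k, measurable_fun setT (X2 k)).
Hypotheses (iX1 : cylinder_independent P1 X1) (iX2 : cylinder_independent P2 X2).
Hypothesis marg : forall k B, measurable B -> P1 (X1 k @^-1` B) = P2 (X2 k @^-1` B).

Let S1 w : seqspace := X1 ^~ w.
Let S2 w : seqspace := X2 ^~ w.
HB.instance Definition _ := isMeasurableFun.Build _ _ _ _ S1 (measurable_to_seqspace mX1).
HB.instance Definition _ := isMeasurableFun.Build _ _ _ _ S2 (measurable_to_seqspace mX2).

(** Both image measures give a cylinder the product of its marginals, so they agree on a generating
    pi-system and hence everywhere. The law of an independent sequence is determined by its
    marginals. *)
Lemma eq_seq_law (E : set seqspace) : measurable E ->
  P1 [set w | E (X1 ^~ w)] = P2 [set w | E (X2 ^~ w)].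
Proof.
move=> mE; rewrite -[LHS]/(pushforward P1 S1 E) -[RHS]/(pushforward P2 S2 E).
apply: (@measure_unique _ R seqspace cylinders (fun=> setT)) => //.
- exact: setI_closed_cylinders.
- move=> _; exists (0%N, fun=> setT) => //=.
  by apply/seteqP; split.
- by rewrite bigcup_const.
- move=> _ [[m B] /= mB <-]; rewrite /pushforward.
  by rewrite [LHS]iX1// [RHS]iX2//; apply: eq_bigr => k _; exact: marg.
- move=> _; have e : P1 setT = 1%E by exact: probability_setT.
  by change (P1 setT < +oo)%E; rewrite e ltry.
Qed.

Lemma eq_seq_Rintegral (h : seqspace -> R) : measurable_fun setT h ->
  P1.-integrable setT (fun w => (h (X1 ^~ w))%:E) ->
  P2.-integrable setT (fun w => (h (X2 ^~ w))%:E) ->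
  \int[P1]_w h (X1 ^~ w) = \int[P2]_w h (X2 ^~ w).
Proof.
move=> mh i1 i2; rewrite /Rintegral; congr fine.
have mh' : measurable_fun setT (EFin \o h) by exact/measurable_EFinP.
have -> : (\int[P1]_w (h (X1 ^~ w))%:E = \int[pushforward P1 S1]_x (h x)%:E)%E.
  by rewrite integral_pushforward.
have -> : (\int[P2]_w (h (X2 ^~ w))%:E = \int[pushforward P2 S2]_x (h x)%:E)%E.
  by rewrite integral_pushforward.
by apply: eq_measure_integral => /= E mE _; exact: eq_seq_law.
Qed.

End SequenceLaw.

Section SequenceTransformations.
Context (R : realType) d (T : measurableType d) (P : probability T R).
Context d' (V : measurableType d') (X : nat -> T -> V).

(** As s is injective, the constraint [B k] on [X (s k)] can be written as [B (t l)] on [X l] with l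
    = s k. *)
Lemma cylinder_independent_reindex (s t : nat -> nat) : cancel s t ->
  mutually_independent P X -> cylinder_independent P (fun k => X (s k)).
Proof.
move=> st iX m B mB.
have := iX [seq s k | k <- iota 0 m] (fun k => B (t k)).
rewrite map_inj_uniq ?iota_uniq; last exact: can_inj st.
move=> /(_ isT (fun k => mB _)); rewrite big_map -{2}[m]subn0 big_mkord => e.
rewrite (_ : [set w | _] = \bigcap_(k in [set` [seq s k | k <- iota 0 m]])
    (X k @^-1` B (t k))).
  by rewrite [LHS]e; apply: eq_bigr => k _; rewrite st.
apply/seteqP; split=> w /=.
  by move=> H _ /= /mapP[k + ->]; rewrite mem_iota/= st; exact: H.
move=> H k km; have := H (s k); rewrite /= st; apply.
by apply/mapP; exists k; rewrite // mem_iota.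
Qed.

Lemma cylinder_independent_comp d'' (W : measurableType d'') (g : V -> W) :
  measurable_fun setT g -> cylinder_independent P X ->
  cylinder_independent P (fun k => g \o X k).
Proof.
move=> mg iX m B mB; rewrite -(iX m (fun k => g @^-1` B k))// => k.
by rewrite -[_ @^-1` _]setTI; exact: mg.
Qed.

Lemma mutually_independent_comp d'' (W : measurableType d'') (g : V -> W) :
  measurable_fun setT g -> mutually_independent P X ->
  mutually_independent P (fun k => g \o X k).
Proof.
move=> mg iX J B uJ mB; apply: (iX J (fun k => g @^-1` B k)) => // k.
by rewrite -[_ @^-1` _]setTI; exact: mg.
Qed.

End SequenceTransformations.

(** * Gluing two independent copies of a sequence at an index j *)

Section Concatenation.
Context (R : realType) d (T : measurableType d) (P : probability T R).
Context d' (V : measurableType d') (X : nat -> T -> V).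
Hypothesis mX : forall k, measurable_fun setT (X k).
Hypothesis iX : cylinder_independent P X.

(** The second block restarts at index 0 on the other factor of the product space. Sums over the two
    blocks then depend on different factors, while for identically distributed terms the law of the
    sequence is unchanged. *)
Definition concat_seq (j : nat) (k : nat) (w : T * T) : V :=
  if (k < j)%N then X k w.1 else X (k - j) w.2.

Lemma measurable_concat_seq j k : measurable_fun setT (concat_seq j k).
Proof.
rewrite /concat_seq; case: (k < j)%N.
  by apply: measurableT_comp.
by apply: measurableT_comp.
Qed.

Let mcyl m (B : nat -> set V) : (forall k, measurable (B k)) ->
  measurable [set w | forall k, (k < m)%N -> B k (X k w)].
Proof.
move=> mB; rewrite (_ : [set w | _] = \bigcap_(k in `I_m) (X k @^-1` B k))//.
by apply: bigcap_measurableType => k _; rewrite -[_ @^-1` _]setTI; exact: mX.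
Qed.

Let PP : probability (T * T)%type R := (P \x P)%E.

Lemma product_probabilityE (A B : set T) : measurable A -> measurable B ->
  PP (A `*` B) = (P A * P B)%E.
Proof. exact: product_measure1E. Qed.

Lemma concat_seq_independent j : cylinder_independent (P \x P)%E (concat_seq j).
Proof.
rewrite -/PP => m B mB; have mX1 k B' : measurable B' -> measurable (X k @^-1` B').
  by move=> mB'; rewrite -[_ @^-1` _]setTI; exact: mX.
transitivity (\prod_(0 <= k < m) P (X (if (k < j)%N then k else (k - j)%N) @^-1` B k))%E;
  last first.
  rewrite big_mkord; apply: eq_bigr => k _; rewrite /concat_seq; case: ifP => kj.
    rewrite (_ : _ @^-1` _ = (X k @^-1` B k) `*` setT).
      by rewrite product_probabilityE ?probability_setT ?mule1//; exact: mX1.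
    by apply/seteqP; split=> [w //|w []].
  rewrite (_ : (fun _ => _) @^-1` _ = setT `*` (X (k - j)%N @^-1` B k)).
    by rewrite product_probabilityE ?probability_setT ?mul1e//; exact: mX1.
  by apply/seteqP; split=> [w //|w []].
(* The cylinder is a rectangle: [minn m j] constraints on the first factor and the remaining [m - j]
   (none when m <= j) on the second. *)
rewrite (_ : [set w | _] = [set w | forall k, (k < minn m j)%N -> B k (X k w)] `*`
    [set w | forall k, (k < m - j)%N -> B (k + j)%N (X k w)]); last first.
  apply/seteqP; split=> -[w1 w2] /=.
    move=> H; split=> k.
      by rewrite leq_min => /andP[km kj]; have := H k km; rewrite /concat_seq kj.
    rewrite ltn_subRL addnC => km; have := H _ km.
    by rewrite /concat_seq ltnNge leq_addl/= addnK.
  move=> [H1 H2] k km; rewrite /concat_seq; case: ltnP => kj.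
    by apply: H1; rewrite leq_min km.
  by have := H2 (k - j)%N; rewrite subnK//; apply; rewrite ltn_sub2rE.
rewrite product_probabilityE; [|exact: mcyl|]; last first.
  by apply: (@mcyl _ (fun k => B (k + j)%N)) => k; exact: mB.
rewrite iX// (iX _ (fun k => mB _)) (@big_cat_nat _ _ _ (minn m j))//= ?geq_minl//.
congr (_ * _)%E.
  rewrite big_mkord; apply: eq_bigr => k _.
  by have := ltn_ord k; rewrite leq_min => /andP[_ ->].
have [mj|jm] := leqP m j.
  by rewrite (eqP mj) big_ord0 big_geq.
rewrite -[X in _ = (\prod_(X <= _ < _) _)%E]add0n big_addn big_mkord.
apply: eq_bigr => k _.
by rewrite ltnNge leq_addl/= addnK.
Qed.

End Concatenation.

(** * Exchangeable projections *)

Section FiniteSums.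
Context d (T : measurableType d) (R : realType) (mu : {measure set T -> \bar R}).
Variables (I : Type) (f : I -> T -> R).
Hypothesis fi : forall i, mu.-integrable setT (EFin \o f i).

Lemma integrable_EFin_sum (s : seq I) :
  mu.-integrable setT (EFin \o fun w => \sum_(i <- s) f i w).
Proof.
have := @integrable_sum _ _ _ mu setT measurableT _ s xpredT (fun i => EFin \o f i).
move=> /(_ (fun i _ => fi i)); apply: eq_integrable => // w _ /=.
by rewrite -sumEFin.
Qed.

Lemma Rintegral_sum (s : seq I) :
  \int[mu]_w (\sum_(i <- s) f i w) = \sum_(i <- s) \int[mu]_w f i w.
Proof.
elim: s => [|a s IH].
  rewrite big_nil; under eq_Rintegral do rewrite big_nil.
  by rewrite /Rintegral integral0.
rewrite big_cons -IH -RintegralD//; last exact: integrable_EFin_sum.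
by apply: eq_Rintegral => w _; rewrite big_cons.
Qed.

End FiniteSums.

(** Extended by the identity, a permutation of m indices acts on infinite sequences, the objects
    whose laws are compared. *)
Definition perm_nat m (s : 'S_m) (k : nat) : nat :=
  if insub k is Some i then nat_of_ord (s i) else k.

Lemma perm_nat_ord m (s : 'S_m) (i : 'I_m) : perm_nat s i = s i.
Proof. by rewrite /perm_nat valK. Qed.

Lemma perm_natK m (s : 'S_m) : cancel (perm_nat s) (perm_nat s^-1%g).
Proof.
move=> k; rewrite {2}/perm_nat; case: insubP => [i _ <-|/negPf km].
  by rewrite perm_nat_ord permK.
by rewrite /perm_nat insubF.
Qed.

(** Double transitivity of the symmetric group: one transposition brings i to i', and a second
    brings the image of l to l' while fixing i'. *)
Lemma perm_of_pairs m (i l i' l' : 'I_m) : i != l -> i' != l' ->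
  exists s : 'S_m, s i = i' /\ s l = l'.
Proof.
move=> il il'; pose t1 := tperm i i'; exists (t1 * tperm (t1 l) l')%g.
split; rewrite permM ?tpermL// tpermD// 1?eq_sym//.
by apply: contra_neq il => e; apply: (@perm_inj _ t1); rewrite tpermL -e.
Qed.

Section ExchangeableProjections.
Context (R : realType) (b : dyson) (n : nat) d (T : measurableType d).
Variables (P : probability T R) (X : nat -> T -> bmx R b n).
Hypothesis mX : forall k, measurable_fun setT (X k).
Hypothesis projX : forall k w, projections (X k w).
Hypothesis iX : mutually_independent P X.
Hypothesis idX : forall k B, measurable B -> P (X k @^-1` B) = P (X 0%N @^-1` B).

Definition psum (m : nat) (w : T) : bmx R b n := \sum_(k < m) X k w.

Lemma measurable_psum m : measurable_fun setT (psum m).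
Proof. by apply: measurable_bmx_sum => k; exact: mX. Qed.

Variables (p q : 'I_n) (k : 'I_(beta_nat b)) (D : set (bmx R b n)).
Hypothesis mD : measurable D.

(** One coordinate of Z_i Z_l tested on the event that the sum of the first m terms lies in [D]; the
    indicator is invariant under permutations of these terms. *)
Definition pair_coord m (i l : nat) (w : T) : R :=
  \1_D (psum m w) * mx_coord p q k (X i w *m X l w : bmx R b n).

Lemma bounded_pair_coord : exists K, forall m i l w, `|pair_coord m i l w| <= K.
Proof.
have [g g1 gE] := mx_coordM R b n.
exists (\sum_(l : 'I_n) \sum_(p : 'I_(beta_nat b)) \sum_(q : 'I_(beta_nat b)) 1).
move=> m i l w; rewrite /pair_coord normrM.
apply: (@le_trans _ _ (1 * `|mx_coord p q k (X i w *m X l w : bmx R b n)|)).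
  by rewrite ler_wpM2r// indicE; case: (_ \in _); rewrite ?normr1 ?normr0.
rewrite mul1r gE; do 3 (apply: le_trans (ler_norm_sum _ _ _) _; apply: ler_sum => ? _).
by rewrite !normrM mulr_ile1// ?mulr_ile1// projections_coord_le1.
Qed.

Lemma integrable_pair_coord m i l : P.-integrable setT (EFin \o pair_coord m i l).
Proof.
have [K KE] := bounded_pair_coord.
apply: measurable_bounded_integrable => //.
- by rewrite (le_lt_trans (probability_le1 _ _)) ?ltry.
- apply: measurable_funM.
    by apply: measurableT_comp (measurable_psum m); exact: measurable_indic.
  by apply: measurable_mx_coord_comp; exact: measurable_bmxM.
- exists K; split; first exact: num_real.
  by move=> x Kx w _; apply: le_trans (KE _ _ _ _) (ltW Kx).
Qed.

(** The integrand is a functional [h] of the sequence. Permuting the sequence keeps its law, leaves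
    the sum inside the indicator unchanged, and moves the two factors. *)
Lemma exchangeable_pair_coord m (s : 'S_m) (i l : 'I_m) :
  \int[P]_w pair_coord m i l w = \int[P]_w pair_coord m (s i) (s l) w.
Proof.
pose h (x : seqspace (bmx R b n)) : R :=
  \1_D (\sum_(k < m) x k) * mx_coord p q k (x i *m x l : bmx R b n).
have hE w : h (fun k => X (perm_nat s k) w) = pair_coord m (s i) (s l) w.
  rewrite /h /pair_coord !perm_nat_ord; congr (\1_D _ * _).
  rewrite /psum [RHS](reindex_inj (@perm_inj _ s)).
  by apply: eq_bigr => a _; rewrite perm_nat_ord.
rewrite -[LHS]/(\int[P]_w h (X ^~ w)).
rewrite (_ : \int[P]_w pair_coord m (s i) (s l) w =
  \int[P]_w h (fun k => X (perm_nat s k) w)); last first.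
  by apply: eq_Rintegral => w _; rewrite hE.
apply: (@eq_seq_Rintegral _ _ _ _ _ _ _ P P X (fun k => X (perm_nat s k))).
- exact: mX.
- by move=> ?; exact: mX.
- exact: (@cylinder_independent_reindex _ _ _ _ _ _ _ id id).
- exact: cylinder_independent_reindex (perm_natK s) iX.
- by move=> a B mB; rewrite idX// [RHS]idX.
- apply: measurable_funM.
    apply: measurableT_comp; first exact: measurable_indic.
    by apply: measurable_bmx_sum => a; exact: measurable_seqspace_coord.
  by apply: measurable_mx_coord_comp; apply: measurable_bmxM;
    exact: measurable_seqspace_coord.
- exact: (integrable_pair_coord m i l).
- under eq_fun do rewrite hE; exact: (integrable_pair_coord m (s i) (s l)).
Qed.

Lemma pair_coord_const m : exists c, forall i l : 'I_m, i != l ->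
  \int[P]_w pair_coord m i l w = c.
Proof.
have [[[i0 l0] /= il0]|N] := pselect (exists il : 'I_m * 'I_m, il.1 != il.2).
  exists (\int[P]_w pair_coord m i0 l0 w) => i l il.
  by have [s [<- <-]] := perm_of_pairs il0 il; rewrite [RHS](exchangeable_pair_coord s).
(* Here m <= 1, there is no pair of distinct indices, and any constant will do. *)
by exists 0 => i l il; case: N; exists (i, l).
Qed.

(* Integrated against the law of (X, Y), this is the defect of the regression
   identity for one real coordinate, tested on the event that S lies in [D]. *)
Definition regression_gap (A B : R) (x y : bmx R b n) : R :=
  \1_D (x + y) * (mx_coord p q k ((x - y) *m (x - y) : bmx R b n) -
   (A * mx_coord p q k ((x + y) *m (x + y) : bmx R b n) + B * mx_coord p q k (x + y))).

Let sg (j i : nat) : R := (-1) ^+ (j <= i)%N.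

Lemma psum_gapE (A B : R) m j w : (j <= m)%N ->
  regression_gap A B (psum j w) (psum m w - psum j w) =
  \sum_(i < m) \sum_(l < m) (sg j i * sg j l - A - B * (i == l)%:R) *
    pair_coord m i l w.
Proof.
move=> jm; rewrite /regression_gap (addrC (psum j w)) subrK.
pose e (i : nat) : bmx R b n := if (j <= i)%N then - X i w else X i w.
have -> : psum j w - (psum m w - psum j w) = \sum_(i < m) e i.
  rewrite /psum (big_ord_widen _ (fun i => X i w) jm) big_mkcond/= -!sumrB.
  apply: eq_bigr => i _; rewrite /e; case: leqP => _.
    by rewrite subr0 sub0r.
  by rewrite subrr subr0.
have -> : mx_coord p q k ((\sum_(i < m) e i) *m (\sum_(i < m) e i) : bmx R b n) =
    \sum_(i < m) \sum_(l < m) sg j i * sg j l * mx_coord p q k (X i w *m X l w : bmx R b n).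
  rewrite mulmx_suml mx_coord_sum; apply: eq_bigr => i _.
  rewrite mulmx_sumr mx_coord_sum; apply: eq_bigr => l _.
  rewrite /e /sg; case: leqP => _; case: leqP => _;
    by rewrite ?mulNmx ?mulmxN ?mx_coordN ?expr1 ?expr0 ?mulrN1 ?mulr1 ?opprK ?mulNr
      ?mul1r.
have -> : mx_coord p q k (psum m w *m psum m w : bmx R b n) =
    \sum_(i < m) \sum_(l < m) mx_coord p q k (X i w *m X l w : bmx R b n).
  rewrite /psum mulmx_suml mx_coord_sum; apply: eq_bigr => i _.
  by rewrite mulmx_sumr mx_coord_sum.
(* Idempotence turns the linear term into a quadratic one: each X_i is X_i X_i, so S is the diagonal
   part of the double sum for S^2. *)
have -> : mx_coord p q k (psum m w) =
    \sum_(i < m) \sum_(l < m) (i == l)%:R * mx_coord p q k (X i w *m X l w : bmx R b n).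
  rewrite /psum mx_coord_sum; apply: eq_bigr => i _.
  rewrite (bigD1 i)//= eqxx mul1r big1 ?addr0 => [|l li].
    by have [_ ->] := projX i w.
  by rewrite eq_sym (negPf li) mul0r.
rewrite !mulr_sumr -big_split -sumrB mulr_sumr; apply: eq_bigr => i _.
rewrite !mulr_sumr -big_split -sumrB mulr_sumr; apply: eq_bigr => l _.
by rewrite /pair_coord /=; ring.
Qed.

Let sum_sg m j : (j <= m)%N -> \sum_(i < m) sg j i = 2 * j%:R - m%:R.
Proof.
move=> jm; rewrite -(big_mkord xpredT (sg j)) (@big_cat_nat _ _ _ j)//=.
rewrite (@eq_big_nat _ _ _ 0 j _ (fun=> 1)); last first.
  by move=> i /andP[_ ij]; rewrite /sg leqNgt ij.
rewrite (@eq_big_nat _ _ _ j m _ (fun=> -1)); last first.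
  by move=> i /andP[ji _]; rewrite /sg ji.
by rewrite !sumr_const_nat subn0 mulNrn natrB//; ring.
Qed.

Let integrable_pair_coordZ m i l (a : R) :
  P.-integrable setT (EFin \o fun w => a * pair_coord m i l w).
Proof.
have := integrableZl measurableT a (integrable_pair_coord m i l).
by apply: eq_integrable => // w _ /=; rewrite EFinM.
Qed.

Lemma integrable_psum_gap (A B : R) m j : (j <= m)%N ->
  P.-integrable setT
    (EFin \o fun w => regression_gap A B (psum j w) (psum m w - psum j w)).
Proof.
move=> jm; pose f (i l : 'I_m) w :=
  (sg j i * sg j l - A - B * (i == l)%:R) * pair_coord m i l w.
have : P.-integrable setT (EFin \o fun w => \sum_(i < m) \sum_(l < m) f i l w).
  do 2 apply: integrable_EFin_sum => ?; exact: integrable_pair_coordZ.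
by apply: eq_integrable => // w _ /=; rewrite psum_gapE.
Qed.

(** The constant c is the common off-diagonal integral. It depends on m, [D] and the coordinate but
    not on the splitting index j, which enters only through the signs. *)
Lemma Rintegral_psum_gap (A B : R) m : A + B = 1 ->
  exists c, forall j, (j <= m)%N ->
  \int[P]_w regression_gap A B (psum j w) (psum m w - psum j w) =
  c * ((2 * j%:R - m%:R) ^+ 2 - m%:R - A * (m%:R * (m%:R - 1))).
Proof.
move=> AB; have [c cE] := pair_coord_const m; exists c => j jm.
under eq_Rintegral do rewrite psum_gapE//.
rewrite Rintegral_sum; last first.
  by move=> i; apply: integrable_EFin_sum => l; exact: integrable_pair_coordZ.
under eq_bigr => i _ do rewrite Rintegral_sum//.
(* Diagonal integrals need not equal c, but their coefficient 1 - A - B is 0, so c may be written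
   there too. The double sum of signs then factors as (2j - m)^2. *)
transitivity (\sum_(i < m) \sum_(l < m) (sg j i * sg j l - A - B * (i == l)%:R) * c).
  apply: eq_bigr => i _; apply: eq_bigr => l _.
  rewrite RintegralZl//; last exact: integrable_pair_coord.
  have [->|il] := eqVneq i l; last by rewrite cE.
  have -> : sg j l * sg j l - A - B * true%:R = 0.
    rewrite mulr1 /sg -expr2 sqrr_sign; lra.
  by rewrite !mul0r.
under eq_bigr => i _ do rewrite -mulr_suml.
rewrite -mulr_suml mulrC; congr (_ * _).
under eq_bigr => i _ do
  rewrite sumrB sumrB -mulr_sumr -[X in _ - X]mulr_sumr sumr_const card_ord sum_sg//.
rewrite !sumrB -mulr_suml sum_sg// sumr_const card_ord.
have -> : \sum_(i < m) B * (\sum_(l < m) (i == l)%:R) = B * m%:R.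
  rewrite -mulr_sumr; congr (_ * _).
  rewrite -[RHS](_ : \sum_(i < m) (1 : R) = _); last first.
    by rewrite sumr_const card_ord.
  apply: eq_bigr => i _; rewrite (bigD1 i)//= eqxx big1 ?addr0// => l li.
  by rewrite eq_sym (negPf li).
have -> : B = 1 - A by rewrite -AB addrC addKr.
have mn (x : R) : x *+ m = x * m%:R by rewrite mulr_natr.
by rewrite (mn (A *+ m)) (mn A); ring.
Qed.

End ExchangeableProjections.

(** * The joint law of a pair of compound variables *)

Section JointLaw.
Context (R : realType) (b : dyson) (n : nat) d (T : measurableType d).
Variables (P : probability T R) (X : nat -> T -> bmx R b n).
Hypothesis mX : forall k, measurable_fun setT (X k).
Hypothesis iX : mutually_independent P X.
Hypothesis idX : forall k B, measurable B -> P (X k @^-1` B) = P (X 0%N @^-1` B).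

(** The event is measurable for the whole sequence, so [X] may be replaced by its concatenation with
    a second copy. There the event is a rectangle, and the second block has become an initial sum of
    length m - j. *)
Lemma psum_independent j m (A B : set (bmx R b n)) : (j <= m)%N ->
  measurable A -> measurable B ->
  P [set w | A (psum X j w) /\ B (psum X m w - psum X j w)] =
  (P (psum X j @^-1` A) * P (psum X (m - j) @^-1` B))%E.
Proof.
move=> jm mA mB.
pose s l (x : seqspace (bmx R b n)) : bmx R b n := \sum_(k < l) x k.
have ms l : measurable_fun setT (s l).
  by apply: measurable_bmx_sum => k; exact: measurable_seqspace_coord.
pose E : set (seqspace (bmx R b n)) := [set x | A (s j x) /\ B (s m x - s j x)].
have mE : measurable E.
  apply: measurableI.
    by rewrite -[X in measurable X]setTI; exact: ms.
  rewrite -[X in measurable X]setTI.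
  exact: (measurable_bmxD (ms m) (measurable_bmxN (ms j))).
have iX1 : cylinder_independent P X.
  exact: (@cylinder_independent_reindex _ _ _ _ _ _ _ id id).
have mX1 k C : measurable C -> measurable (X k @^-1` C).
  by move=> mC; rewrite -[_ @^-1` _]setTI; exact: mX.
have mpsum l C : measurable C -> measurable (psum X l @^-1` C).
  by move=> mC; rewrite -[_ @^-1` _]setTI; exact: measurable_psum.
transitivity ((P \x P)%E [set w | E (concat_seq X j ^~ w)]).
  apply: (eq_seq_law mX (measurable_concat_seq mX j) iX1
    (concat_seq_independent mX iX1 j)) => // k C mC.
  have marg l : P (X k @^-1` C) = P (X l @^-1` C) by rewrite (idX k mC) (idX l mC).
  rewrite /concat_seq; case: (k < j)%N.
    rewrite (_ : (fun _ => _) @^-1` _ = (X k @^-1` C) `*` setT).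
      by rewrite product_probabilityE ?probability_setT ?mule1//; exact: mX1.
    by apply/seteqP; split=> [w //|w []].
  rewrite (_ : (fun _ => _) @^-1` _ = setT `*` (X (k - j)%N @^-1` C)).
    by rewrite product_probabilityE ?probability_setT ?mul1e//; exact: mX1.
  by apply/seteqP; split=> [w //|w []].
rewrite -product_probabilityE; [|exact: mpsum|exact: mpsum].
congr ((P \x P)%E _); apply/seteqP.
have sj w : s j (concat_seq X j ^~ w) = psum X j w.1.
  by apply: eq_bigr => k _; rewrite /concat_seq ltn_ord.
have smj w : s m (concat_seq X j ^~ w) - s j (concat_seq X j ^~ w) = psum X (m - j) w.2.
  rewrite sj /s -(big_mkord xpredT (fun k => concat_seq X j k w)).
  rewrite (@big_cat_nat _ _ _ j)//=.
  have -> : \sum_(0 <= k < j) concat_seq X j k w = psum X j w.1.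
    by rewrite big_mkord -sj.
  rewrite (addrC (psum X j w.1)) addrK -[X in \sum_(X <= _ < _) _]add0n big_addn big_mkord.
  by apply: eq_bigr => k _; rewrite /concat_seq ltnNge leq_addl/= addnK.
by split=> w; rewrite /E /= smj sj.
Qed.

Definition split_sums (j m : nat) (w : T) : bmx R b n * bmx R b n :=
  (psum X j w, psum X m w - psum X j w).

Lemma measurable_split_sums j m : measurable_fun setT (split_sums j m).
Proof.
apply: measurable_fun_pair; first exact: measurable_psum.
by apply: measurable_bmxD; [|apply: measurable_bmxN]; exact: measurable_psum.
Qed.

Let split_sums_mixin j m := isMeasurableFun.Build _ _ _ _ _ (measurable_split_sums j m).
Let split_sums_mfun j m : {mfun T >-> (bmx R b n * bmx R b n)%type} :=
  HB.pack (split_sums j m) (split_sums_mixin j m).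

Variables (wt : nat -> R) (wt_ge0 : forall j, 0 <= wt j).

Let wt2_ge0 j m : 0 <= wt j * wt (m - j)%N. Proof. exact: mulr_ge0. Qed.

(** The unnormalised part of the joint law of two compound variables coming from m terms in total, j
    in the first and m - j in the second. *)
Definition antidiagonal_law (m : nat) : {measure set (bmx R b n * bmx R b n) -> \bar R} :=
  msum (fun j => mscale (NngNum (wt2_ge0 j m)) (distribution P (split_sums_mfun j m))) m.+1.

Variable nu : probability (bmx R b n) R.
Hypothesis nuE : forall B, measurable B ->
  nu B = (\sum_(j <oo) (wt j)%:E * P (psum X j @^-1` B))%E.

Context d' (T' : measurableType d') (P' : probability T' R).
Variables (Y Z : {RV P' >-> bmx R b n}).
Hypotheses (Y_nu : has_law P' Y nu) (Z_nu : has_law P' Z nu)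
  (YZ : independent_RV2 P' Y Z).

Definition RV_pair (w : T') : bmx R b n * bmx R b n := (Y w, Z w).

Lemma measurable_RV_pair : measurable_fun setT RV_pair.
Proof. exact: measurable_fun_pair. Qed.

HB.instance Definition _ := isMeasurableFun.Build _ _ _ _ RV_pair measurable_RV_pair.

Lemma antidiagonal_law_rect A B : measurable A -> measurable B ->
  mseries antidiagonal_law 0 (A `*` B) = (nu A * nu B)%E.
Proof.
move=> mA mB.
pose f C j := wt j * fine (P (psum X j @^-1` C)).
have mpsum l C : measurable C -> measurable (psum X l @^-1` C).
  by move=> mC; rewrite -[_ @^-1` _]setTI; exact: measurable_psum.
have fE C j : measurable C -> (f C j)%:E = ((wt j)%:E * P (psum X j @^-1` C))%E.
  by move=> mC; rewrite EFinM fineK// fin_num_measure//; exact: mpsum.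
have nufE C : measurable C -> nu C = (\sum_(j <oo) (f C j)%:E)%E.
  by move=> mC; rewrite nuE//; apply: eq_eseriesr => j _; rewrite fE.
have f0 C j : 0 <= f C j by rewrite mulr_ge0// fine_ge0.
rewrite (nufE A)// (nufE B)// -nneseries_cauchy_product//; last first.
  by rewrite -nufE// (le_lt_trans (probability_le1 _ _))// ltry.
rewrite /mseries; apply: eq_eseriesr => m _; rewrite /antidiagonal_law /= /msum.
apply: eq_bigr => j _; transitivity ((wt j * wt (m - j)%N)%:E *
    P [set w | A (psum X j w) /\ B (psum X m w - psum X j w)%R])%E; first by [].
rewrite psum_independent ?leq_ord// EFinM [in RHS]EFinM (fE A)// (fE B)//.
by rewrite -!muleA; congr (_ * _)%E; rewrite muleCA.
Qed.

Lemma joint_law E : measurable E -> P' (RV_pair @^-1` E) = mseries antidiagonal_law 0 E.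
Proof.
(* Both measures take product values on rectangles, the first by independence of [Y] and [Z], the
   second by the Cauchy product, so both equal the product measure. *)
move=> mE; transitivity ((nu \x nu)%E E).
  apply/esym.
  apply: (@product_measure_unique _ _ _ _ _ nu nu (pushforward P' RV_pair)) => //.
  by move=> A B mA mB; have := YZ mA mB; rewrite Y_nu// Z_nu//.
by apply: product_measure_unique => // A B mA mB; exact: antidiagonal_law_rect.
Qed.

Lemma ge0_integral_joint_law (g : bmx R b n * bmx R b n -> \bar R) :
  measurable_fun setT g -> (forall z, 0 <= g z)%E ->
  (\int[P']_w g (Y w, Z w) = \sum_(m <oo) \sum_(j < m.+1)
    (wt j * wt (m - j)%N)%:E * \int[P]_w g (split_sums j m w))%E.
Proof.
move=> mg g0.
transitivity (\int[pushforward P' RV_pair]_z g z)%E.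
  by rewrite ge0_integral_pushforward.
transitivity (\int[mseries antidiagonal_law 0]_z g z)%E.
  by apply: eq_measure_integral => E mE _; exact: joint_law.
rewrite ge0_integral_measure_series//; apply: eq_eseriesr => m _.
rewrite ge0_integral_measure_sum//; apply: eq_bigr => j _.
by rewrite ge0_integral_mscale// ge0_integral_pushforward.
Qed.

End JointLaw.

(** Brings a signed integrand within reach of [ge0_integral_joint_law]; finiteness of the negative
    part is what permits subtraction. *)
Lemma integral_comp_posneg d (T : measurableType d) (R : realType) (U : Type)
    (mu : {measure set T -> \bar R}) (f : U -> \bar R) (h : T -> U) :
  mu.-integrable setT (f \o h) ->
  (\int[mu]_w f (h w) = \int[mu]_w f^\+ (h w) - \int[mu]_w f^\- (h w))%E /\
  (\int[mu]_w f^\- (h w))%E \is a fin_num.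
Proof.
move=> fi; have -> : (fun w => f^\- (h w))%E = ((f \o h)^\-)%E.
  by apply/funext => w; rewrite [LHS]funenegE [RHS]funenegE.
split; last exact: integrable_neg_fin_num.
have -> : (fun w => f^\+ (h w))%E = ((f \o h)^\+)%E.
  by apply/funext => w; rewrite [LHS]funeposE [RHS]funeposE.
exact: integralE.
Qed.

(** * Moments, rotation invariance and regression defect of a compound law *)

Section CompoundLaw.
Context (R : realType) (b : dyson) (n : nat) d (T : measurableType d).
Variables (P : probability T R) (X : nat -> T -> bmx R b n).
Hypothesis mX : forall k, measurable_fun setT (X k).
Hypothesis projX : forall k w, projections (X k w).
Hypothesis iX : mutually_independent P X.
Hypothesis idX : forall k B, measurable B -> P (X k @^-1` B) = P (X 0%N @^-1` B).
Variables (wt : nat -> R) (wt_ge0 : forall j, 0 <= wt j).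
Variable nu : probability (bmx R b n) R.
Hypothesis nuE : forall B, measurable B ->
  nu B = (\sum_(j <oo) (wt j)%:E * P (psum X j @^-1` B))%E.

Let psum_mixin m := isMeasurableFun.Build _ _ _ _ _ (measurable_psum mX m).
Let psum_mfun m : {mfun T >-> bmx R b n} := HB.pack (psum X m) (psum_mixin m).

(** A sum of j projections has coordinates of absolute value at most j, so a second moment of [nu]
    is at most the sum of the j^2 [wt j]. *)
Lemma compound_second_moments (K : R) :
  (forall l, \sum_(j < l) j%:R ^+ 2 * wt j <= K) -> finite_second_moments nu.
Proof.
move=> KE p q k.
pose m_ (j : nat) : {measure set (bmx R b n) -> \bar R} :=
  mscale (NngNum (wt_ge0 j)) (distribution P (psum_mfun j)).
have mc : measurable_fun setT (fun M : bmx R b n => ((mx_coord p q k M) ^+ 2)%:E).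
  apply/measurable_EFinP; apply: measurable_funX; exact: measurable_mx_coord.
have c0 (M : bmx R b n) : (0 <= ((mx_coord p q k M) ^+ 2)%:E)%E.
  by rewrite lee_fin sqr_ge0.
rewrite (_ : (\int[nu]_M _)%E =
    (\int[mseries m_ 0]_M ((mx_coord p q k M) ^+ 2)%:E)%E); last first.
  by apply: eq_measure_integral => E mE _; exact: nuE.
rewrite ge0_integral_measure_series//.
apply: (@le_lt_trans _ _ K%:E); last exact: ltry.
apply: (@le_trans _ _ (\sum_(j <oo) (j%:R ^+ 2 * wt j)%:E)%E).
  apply: lee_nneseries => [j _ _|j _]; first by apply: integral_ge0 => M _; exact: c0.
  rewrite ge0_integral_mscale//= ge0_integral_distribution// (mulrC (j%:R ^+ 2)) EFinM.
  rewrite lee_wpmul2l ?lee_fin//.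
  rewrite -[leRHS]mule1 -(@probability_setT _ _ _ P) -integral_cst//.
  apply: ge0_le_integral => //.
  - by move=> w _; exact: c0.
  - exact: measurableT_comp (measurable_psum mX j).
  move=> w _; rewrite /= lee_fin -[leLHS]real_normK ?num_real//.
  rewrite lerXn2r ?nnegrE// mx_coord_sum (le_trans (ler_norm_sum _ _ _))//.
  apply: (@le_trans _ _ (\sum_(l < j) 1)); last by rewrite sumr_const card_ord.
  by apply: ler_sum => l _; exact: projections_coord_le1.
apply: lime_le.
  by apply: is_cvg_nneseries => j _ _; rewrite lee_fin mulr_ge0// exprn_ge0.
by near=> l; rewrite sumEFin lee_fin big_mkord.
Unshelve. all: by end_near. Qed.

Lemma compound_hermitian : law_on_hermitian nu.
Proof.
rewrite /law_on_hermitian -(@probability_setT _ _ _ nu) !nuE//; last first.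
  exact: measurable_hermitian_space.
apply: eq_eseriesr => j _; congr (_ * P _)%E; apply/seteqP; split=> // w _.
rewrite /hermitian_space /psum /=.
elim/big_ind: _ => [|M N HM HN|l _]; first exact: mx_adj0.
  by rewrite mx_adjD HM HN.
by have [] := projX l w.
Qed.

(** Rotation is additive, so it acts term by term; the rotated terms are again independent with the
    same marginals. *)
Lemma compound_rotation_invariant :
  (forall U B, unitary_group U -> measurable B ->
    P (X 0%N @^-1` (rotate U @^-1` B)) = P (X 0%N @^-1` B)) ->
  rotation_invariant nu.
Proof.
move=> rotX U uU B mB.
have mrot C : measurable C -> measurable (rotate U @^-1` C).
  by move=> mC; rewrite -[_ @^-1` _]setTI; exact: measurable_rotate.
rewrite !nuE//; last exact: mrot.
apply: eq_eseriesr => j _; congr (_ * _)%E.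
pose E : set (seqspace (bmx R b n)) := [set x | B (\sum_(k < j) x k)].
have mE : measurable E.
  rewrite -[E]setTI; apply: (@measurable_bmx_sum _ _ _ _ _ _ _
    (fun (k : 'I_j) (x : seqspace (bmx R b n)) => x k)) => // k.
  exact: measurable_seqspace_coord.
have iX1 : cylinder_independent P X.
  exact: (@cylinder_independent_reindex _ _ _ _ _ _ _ id id).
transitivity (P [set w | E (fun k => rotate U (X k w))]).
  congr (P _); apply/seteqP; split=> w; rewrite /E /= /psum rotate_sum//.
apply: (@eq_seq_law _ _ _ _ _ _ _ P P (fun k => rotate U \o X k) X) => //.
- by move=> k; apply: measurableT_comp (mX k); exact: measurable_rotate.
- exact: cylinder_independent_comp (measurable_rotate U) iX1.
- move=> k C mC; rewrite [RHS]idX// -(rotX U)//.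
  by rewrite -[LHS]/(P (X k @^-1` (rotate U @^-1` C))) idX//; exact: mrot.
Qed.

Context d' (T' : measurableType d') (P' : probability T' R).
Variables (Y Z : {RV P' >-> bmx R b n}).
Hypotheses (Y_nu : has_law P' Y nu) (Z_nu : has_law P' Z nu)
  (YZ : independent_RV2 P' Y Z).
Variables (A B : R).
Hypothesis AB : A + B = 1.
Hypothesis wt_variance : forall m, \sum_(j < m.+1) wt j * wt (m - j)%N *
  ((2 * j%:R - m%:R) ^+ 2 - m%:R - A * (m%:R * (m%:R - 1))) = 0.
Variables (p q : 'I_n) (k : 'I_(beta_nat b)) (D : set (bmx R b n)).
Hypothesis mD : measurable D.

Let g (z : bmx R b n * bmx R b n) : \bar R := (regression_gap p q k D A B z.1 z.2)%:E.

Let mg : measurable_fun setT g.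
Proof.
have mS : measurable_fun setT (fun z : bmx R b n * bmx R b n => z.1 + z.2).
  by apply: measurable_bmxD.
have mDif : measurable_fun setT (fun z : bmx R b n * bmx R b n => z.1 - z.2).
  by apply: measurable_bmxD => //; exact: measurable_bmxN.
apply/measurable_EFinP; apply: measurable_funM.
  by apply: measurableT_comp mS; exact: measurable_indic.
apply: measurable_funB.
  by apply: measurable_mx_coord_comp; exact: measurable_bmxM.
apply: measurable_funD; apply: measurable_funM => //; apply: measurable_mx_coord_comp => //.
exact: measurable_bmxM.
Qed.

(** The integrals of the positive and negative parts are both series over m of nonnegative terms.
    For each m the two terms coincide, because their difference is c times the sum in
    [wt_variance]. *)
Lemma integral_regression_gap :
  P'.-integrable setT (fun w => (regression_gap p q k D A B (Y w) (Z w))%:E) ->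
  (\int[P']_w (regression_gap p q k D A B (Y w) (Z w))%:E = 0)%E.
Proof.
move=> gi; pose h w := (Y w, Z w).
have law f := ge0_integral_joint_law mX iX idX wt_ge0 nuE Y_nu Z_nu YZ (g := f).
have [-> fin] := @integral_comp_posneg _ _ _ _ P' g h gi.
suff -> : (\int[P']_w (g^\+ (h w)) = \int[P']_w (g^\- (h w)))%E by rewrite subee.
rewrite /h !law//; [|exact: measurable_funeneg|exact: measurable_funepos].
apply: eq_eseriesr => m _.
have [c cE] := Rintegral_psum_gap mX projX iX idX p q k mD m AB.
have gint j : (j <= m)%N -> P.-integrable setT (g \o split_sums X j m).
  by move=> jm; exact: integrable_psum_gap.
have gpm j : (j <= m)%N -> (\int[P]_w g^\+ (split_sums X j m w) =
    \int[P]_w g^\- (split_sums X j m w) +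
    (c * ((2 * j%:R - m%:R) ^+ 2 - m%:R - A * (m%:R * (m%:R - 1))))%:E)%E.
  move=> jm; rewrite -cE// fineK; last exact: integrable_fin_num (gint j jm).
  have [E finj] := integral_comp_posneg (gint j jm).
  by rewrite [X in (_ = _ + X)%E]E addeC subeK.
under eq_bigr => j _ do rewrite gpm ?leq_ord// muleDr ?fin_num_adde_defl// -EFinM.
rewrite big_split/= -[RHS]adde0; congr (_ + _)%E.
rewrite sumEFin; congr EFin.
transitivity (c * 0); last exact: mulr0.
rewrite -[in RHS](wt_variance m) mulr_sumr; apply: eq_bigr => j _; ring.
Qed.

End CompoundLaw.

(** * Regression *)

Section SquareIntegrable.
Context d (T : measurableType d) (R : realType) (P : probability T R).
Implicit Types f g h : T -> R.

Definition square_integrable f : Prop :=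
  measurable_fun setT f /\ P.-integrable setT (fun w => (f w ^+ 2)%:E).

Lemma square_integrable_cst (a : R) : square_integrable (fun=> a).
Proof.
by split; [exact: measurable_cst|exact: finite_measure_integrable_cst].
Qed.

(** The bound 2 (f^2 + g^2) serves both for the product f g and for (f + g)^2. *)
Lemma square_integrable_dominated f g h : measurable_fun setT h ->
  square_integrable f -> square_integrable g ->
  (forall w, `|h w| <= (f w ^+ 2 + g w ^+ 2) *+ 2) -> P.-integrable setT (EFin \o h).
Proof.
move=> mh [mf fi] [mg gi] H.
have := integrableZl measurableT 2 (integrableD measurableT fi gi).
apply: le_integrable => //; first exact/measurable_EFinP.
by move=> w _ /=; rewrite lee_fin (le_trans (H w))// mulr_natl ler_norm.
Qed.

Lemma integrable_mul f g : square_integrable f -> square_integrable g ->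
  P.-integrable setT (EFin \o (fun w => f w * g w)).
Proof.
move=> fi gi; have [mf _] := fi; have [mg _] := gi.
apply: (square_integrable_dominated _ fi gi); first exact: measurable_funM.
move=> w; rewrite ler_norml; apply/andP; split; nra.
Qed.

Lemma square_integrableD f g : square_integrable f -> square_integrable g ->
  square_integrable (fun w => f w + g w).
Proof.
move=> fi gi; have [mf _] := fi; have [mg _] := gi.
have mfg : measurable_fun setT (fun w => f w + g w) by exact: measurable_funD.
split=> //; apply: (square_integrable_dominated _ fi gi); first exact: measurable_funX.
move=> w; rewrite ger0_norm ?sqr_ge0// -subr_ge0.
by rewrite (_ : _ - _ = (f w - g w) ^+ 2) ?sqr_ge0//; ring.
Qed.

Lemma square_integrableN f : square_integrable f -> square_integrable (fun w => - f w).
Proof.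
case=> mf fi; split; first exact: measurable_funN.
by under eq_fun do rewrite sqrrN.
Qed.

Lemma square_integrable_integrable f : square_integrable f ->
  P.-integrable setT (EFin \o f).
Proof.
move=> fi; have := integrable_mul fi (square_integrable_cst 1).
by under eq_fun do rewrite mulr1.
Qed.

End SquareIntegrable.

Section MatrixRegression.
Context (R : realType) (b : dyson) (n : nat) d (T : measurableType d).
Variable P : probability T R.
Implicit Types M N : T -> bmx R b n.

Definition square_integrable_mx M : Prop :=
  forall i j k, square_integrable P (fun w => mx_coord i j k (M w)).

Lemma square_integrable_mxD M N : square_integrable_mx M -> square_integrable_mx N ->
  square_integrable_mx (fun w => M w + N w).
Proof.
move=> HM HN i j k; under eq_fun do rewrite mx_coordD.
exact: square_integrableD.
Qed.

Lemma square_integrable_mxB M N : square_integrable_mx M -> square_integrable_mx N ->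
  square_integrable_mx (fun w => M w - N w).
Proof.
move=> HM HN i j k; under eq_fun do rewrite mx_coordB.
by apply: square_integrableD => //; exact: square_integrableN.
Qed.

Lemma integrable_mulmx M N i j k : square_integrable_mx M -> square_integrable_mx N ->
  P.-integrable setT (EFin \o (fun w => mx_coord i j k (M w *m N w : bmx R b n))).
Proof.
move=> HM HN; have [g _ gE] := mx_coordM R b n.
under eq_fun do rewrite gE.
apply: integrable_EFin_sum => l; apply: integrable_EFin_sum => p.
apply: integrable_EFin_sum => q.
have := integrableZl measurableT (g k p q) (integrable_mul (HM i l p) (HN l j q)).
by apply: eq_integrable => // w _ /=; rewrite EFinM.
Qed.

Lemma has_law_square_integrable (nu : probability (bmx R b n) R)
    (Y : {RV P >-> bmx R b n}) :
  finite_second_moments nu -> has_law P Y nu -> square_integrable_mx Y.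
Proof.
move=> nu2 Ynu i j k.
have mc : measurable_fun setT (fun w => mx_coord i j k (Y w)).
  exact: measurable_mx_coord_comp.
split=> //; apply/integrableP; split.
  by apply/measurable_EFinP; exact: measurable_funX.
have := nu2 i j k; congr (_ < _)%E.
transitivity (\int[distribution P Y]_M ((mx_coord i j k M ^+ 2)%:E))%E.
  by apply: eq_measure_integral => E mE _; apply/esym; exact: Ynu.
rewrite ge0_integral_distribution//.
- by apply: eq_integral => w _ /=; rewrite ger0_norm// sqr_ge0.
- apply/measurable_EFinP; apply: measurable_funX; exact: measurable_mx_coord.
- by move=> M; rewrite lee_fin sqr_ge0.
Qed.

End MatrixRegression.

Lemma coef_of_real0 (R : realType) (b : dyson) : coef_of_real b (0 : R) = 0.
Proof. by case: b. Qed.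

(** Abstract form of the result: it concerns any compound of independent projections with a common
    rotation invariant law, and the weights enter only through their sign, a second moment bound and
    the variance identity. *)
Lemma compound_meixner (R : realType) (b : dyson) (n : nat) d (T : measurableType d)
    (P : probability T R) (X : nat -> T -> bmx R b n)
    (mX : forall k, measurable_fun setT (X k))
    (projX : forall k w, projections (X k w))
    (iX : mutually_independent P X)
    (idX : forall k B, measurable B -> P (X k @^-1` B) = P (X 0%N @^-1` B))
    (rotX : forall U B, unitary_group U -> measurable B ->
      P (X 0%N @^-1` (rotate U @^-1` B)) = P (X 0%N @^-1` B))
    (wt : nat -> R) (wt_ge0 : forall j, 0 <= wt j) (nu : probability (bmx R b n) R)
    (nuE : forall B, measurable B ->
      nu B = (\sum_(j <oo) (wt j)%:E * P (psum X j @^-1` B))%E)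
    (K : R) (wt_moment : forall l, \sum_(j < l) j%:R ^+ 2 * wt j <= K)
    (A B : R) (AB : A + B = 1)
    (wt_variance : forall m, \sum_(j < m.+1) wt j * wt (m - j)%N *
      ((2 * j%:R - m%:R) ^+ 2 - m%:R - A * (m%:R * (m%:R - 1))) = 0) :
  meixner_ensemble nu A B 0.
Proof.
have nu2 := compound_second_moments mX projX wt_ge0 nuE wt_moment.
split=> //.
- exact: (compound_hermitian projX nuE).
- exact: (compound_rotation_invariant mX iX idX nuE rotX).
move=> d' T' P' Y Z Ynu Znu YZ S i j k.
have Y2 := has_law_square_integrable nu2 Ynu.
have Z2 := has_law_square_integrable nu2 Znu.
have S2 : square_integrable_mx P' S by exact: square_integrable_mxD.
have D2 := square_integrable_mxB Y2 Z2.
have Wi := integrable_mulmx i j k D2 D2.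
have VE M : mx_coord i j k (coef_of_real b A *: (M *m M) + coef_of_real b B *: M +
    (coef_of_real b 0)%:M : bmx R b n) =
    A * mx_coord i j k (M *m M : bmx R b n) + B * mx_coord i j k M.
  by rewrite !mx_coordD !mx_coordZ coef_of_real0 raddf0 mx_coord0 addr0.
have Vi : P'.-integrable setT (EFin \o (fun w => A * mx_coord i j k (S w *m S w : bmx R b n) +
    B * mx_coord i j k (S w))).
  have i1 := integrableZl measurableT A (integrable_mulmx i j k S2 S2).
  have i2 := integrableZl measurableT B (square_integrable_integrable (S2 i j k)).
  have := integrableD measurableT i1 i2.
  by apply: eq_integrable => // w _ /=; rewrite EFinD !EFinM.
rewrite (_ : mx_coord i j k \o (fun w => _ + _) = fun w =>
    A * mx_coord i j k (S w *m S w : bmx R b n) + B * mx_coord i j k (S w)); last first.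
  by apply/funext => w /=; rewrite VE.
split=> //.
(* The candidate is a function of S with polynomial coordinates, so its preimages are pulled back by
   S from Borel sets of matrices. *)
- move=> C mC; exists ((fun M : bmx R b n => A * mx_coord i j k (M *m M : bmx R b n) +
    B * mx_coord i j k M) @^-1` C); last by rewrite setTI.
  rewrite -[X in measurable X]setTI.
  have mm : measurable_fun setT (fun M : bmx R b n => A * mx_coord i j k (M *m M : bmx R b n) +
      B * mx_coord i j k M).
    apply: measurable_funD; apply: measurable_funM => //;
      apply: measurable_mx_coord_comp => //; exact: measurable_bmxM.
  exact: mm.
(* Every event of sigma(S) is the preimage of some [D]. Over it, the two sides of the averaging
   identity differ by the integral of [regression_gap]. *)
move=> _ [D mD <-]; rewrite setTI.
have mS : measurable (S @^-1` D).
  by rewrite -[X in measurable X]setTI; apply: (measurable_bmxD _ _).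
have gapE w : ((regression_gap i j k D A B (Y w) (Z w))%:E =
   (\1_(S @^-1` D) w * (mx_coord i j k ((Y w - Z w) *m (Y w - Z w) : bmx R b n) -
    (A * mx_coord i j k (S w *m S w : bmx R b n) + B * mx_coord i j k (S w))))%:E)%E.
  by [].
pose gap w := (mx_coord i j k ((Y w - Z w) *m (Y w - Z w) : bmx R b n) -
    (A * mx_coord i j k (S w *m S w : bmx R b n) + B * mx_coord i j k (S w))).
have gapi : P'.-integrable setT (EFin \o gap).
  by have := integrableB measurableT Wi Vi; apply: eq_integrable => // w _ /=; rewrite EFinB.
have gapS : (fun w => (regression_gap i j k D A B (Y w) (Z w))%:E) =
    (EFin \o gap) \_ (S @^-1` D).
  apply/funext => w; rewrite gapE patchE indicE; case: ifP => _; rewrite ?mul1r ?mul0r//.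
have := integral_regression_gap mX projX iX idX wt_ge0 nuE Ynu Znu YZ AB wt_variance
  (p := i) (q := j) (k := k) mD.
rewrite gapS -integral_mkcond -integrable_mkcond//.
move=> /(_ (integrableS measurableT mS (@subsetT _ _) gapi)).
have WiS := integrableS measurableT mS (@subsetT _ _) Wi.
have ViS := integrableS measurableT mS (@subsetT _ _) Vi.
under eq_integral do rewrite /= EFinB.
rewrite integralB// => /eqP; rewrite sube_eq ?add0e; [|exact: integrable_fin_num|].
  by move=> /eqP.
exact: fin_num_adde_defr.
Qed.

(** * Negative binomial ensembles *)

Lemma probability_setI_full d (T : measurableType d) (R : realType)
    (P : probability T R) (A B : set T) :
  measurable A -> measurable B -> P B = 1%E -> P (A `&` B) = P A.
Proof.
move=> mA mB PB.
have nB : P (~` B) = 0%E by rewrite probability_setC// PB subee.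
rewrite [RHS](measureDI P mA mB) [X in (X + _)%E](_ : _ = 0%E) ?add0e//.
apply/eqP; rewrite eq_le measure_ge0 andbT -nB.
apply: le_measure; rewrite ?inE; [exact: measurableD|exact: measurableC|].
by move=> w [].
Qed.

(** * The Bernoulli ensemble: invariance and support on projections *)

Section BernoulliEnsemble.
Context (R : realType) (b : dyson) (n : nat).
Variables (haar : probability (bmx R b n) R) (haarP : is_haar haar).
Variable q : nat -> R.

(** The two point masses sit at matrices fixed by every rotation. For the other terms, rotating by U
    after V is rotating by U V, and left invariance of the Haar measure absorbs U. *)
Lemma bernoulli_rotate (U : bmx R b n) B : unitary_group U -> measurable B ->
  bernoulli_ensemble haar q (rotate U @^-1` B) = bernoulli_ensemble haar q B.
Proof.
move=> uU mB; have [_ inv] := haarP.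
rewrite /bernoulli_ensemble !diracE.
have mem M : (M \in rotate U @^-1` B) = (rotate U M \in B).
  by apply/idP/idP; rewrite !inE.
rewrite !mem rotate0 rotate1//; congr (_ + _ + _)%E.
apply: eq_bigr => m _; congr (_ * _)%E; rewrite /projection_law.
rewrite -(inv U uU [set V | B (rotate V (I_mn R b n m))]); last first.
  by rewrite -[X in measurable X]setTI; exact: (measurable_rotatel (I_mn R b n m)).
by congr (haar _); apply/seteqP; split=> V; rewrite /= rotateM.
Qed.

Lemma bernoulli_projections : (1 <= n)%N ->
  bernoulli_ensemble haar q (@projections R b n) = 1%E.
Proof.
move=> n1; rewrite /bernoulli_ensemble !diracE.
rewrite !mem_set; [|exact: projections1|exact: projections0].
have [hU _] := haarP.
under eq_bigr => m _.
  have -> : projection_law haar m (@projections R b n) = 1%E.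
    apply/eqP; rewrite eq_le probability_le1 ?andTb; last first.
      by rewrite -[X in measurable X]setTI;
        apply: (measurable_rotatel (I_mn R b n m)) => //; exact: measurable_projections.
    rewrite -hU; apply: le_measure; rewrite ?inE; first exact: measurable_unitary_group.
      by rewrite -[X in measurable X]setTI;
        apply: (measurable_rotatel (I_mn R b n m)) => //; exact: measurable_projections.
    by move=> V uV; apply: projections_rotate => //; exact: projections_I_mn.
  rewrite mule1; over.
(* All components give mass 1, so the weights must add up to 1; n >= 1 is what allows q_n to be
   split off from [qsum]. *)
rewrite !mule1 sumEFin -!EFinD /qsum big_nat_recr//=; congr EFin; ring.
Qed.

End BernoulliEnsemble.

Section ProjectOnto.
Context (R : realType) (b : dyson) (n : nat).

(* Passing from X_k to [to_projection \o X_k], which has the same law, makes the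
   variables bounded everywhere and not only almost surely. *)
Definition to_projection (M : bmx R b n) : bmx R b n :=
  if `[< projections M >] then M else 0.

Lemma to_projectionP M : projections (to_projection M).
Proof. by rewrite /to_projection; case: asboolP => // _; exact: projections0. Qed.

Lemma measurable_to_projection : measurable_fun setT to_projection.
Proof.
apply: measurable_fun_ifT => //.
apply: (measurable_fun_bool true).
rewrite setTI (_ : _ @^-1` _ = @projections R b n); first exact: measurable_projections.
by apply/seteqP; split=> M /= /asboolP.
Qed.

Lemma to_projection_law d (T : measurableType d) (P : probability T R)
    (X : T -> bmx R b n) B :
  measurable_fun setT X -> P (X @^-1` @projections R b n) = 1%E -> measurable B ->
  P ((to_projection \o X) @^-1` B) = P (X @^-1` B).
Proof.
move=> mX PX mB.
have mpre (C : set (bmx R b n)) : measurable C -> measurable (X @^-1` C).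
  by move=> mC; rewrite -[X in measurable X]setTI; exact: mX.
have mp := mpre _ (@measurable_projections R b n).
rewrite -(probability_setI_full _ mp PX); last first.
  apply: (mpre (to_projection @^-1` B)).
  by rewrite -[X in measurable X]setTI; exact: measurable_to_projection.
rewrite -[RHS](probability_setI_full _ mp PX); last exact: mpre.
congr (P _); apply/seteqP; split=> w /= [Bw pw]; split=> //; move: Bw;
  by rewrite /to_projection; case: asboolP.
Qed.

End ProjectOnto.

Section NegativeBinomialEnsemble.
Context (R : realType) (b : dyson) (n : nat) d (T : measurableType d).
Variables (P : probability T R) (N : {RV P >-> nat}) (X : nat -> {RV P >-> bmx R b n}).
Hypothesis NX : independent_of_sequence P N X.

Lemma compound_lawE (B : set (bmx R b n)) : measurable B ->
  P ((fun w => \sum_(k < N w) X k w) @^-1` B) =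
  (\sum_(j <oo) P (N @^-1` [set j]) * P (psum X j @^-1` B))%E.
Proof.
move=> mB; pose F j := N @^-1` [set j] `&` psum X j @^-1` B.
have mN j : measurable (N @^-1` [set j]).
  by rewrite -[X in measurable X]setTI; exact: measurable_funP.
have mpsum j : measurable (psum X j @^-1` B).
  by rewrite -[X in measurable X]setTI; apply: measurable_psum => // k;
    exact: measurable_funP.
rewrite (_ : _ @^-1` B = \bigcup_j F j); last first.
  apply/seteqP; split=> w /=; first by move=> Bw; exists (N w).
  by move=> [j _ [/= e]]; rewrite /psum -e.
have mF j : measurable (F j) by exact: measurableI.
rewrite measure_semi_bigcup//; last 2 first.
- apply/trivIsetP => i j _ _ ij; rewrite -subset0 => w [[/= e _] [/= e' _]].
  by rewrite -e -e' eqxx in ij.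
- exact: bigcupT_measurable.
apply: eq_eseriesr => j _; apply: NX => //.
(* The partial sum must be measurable for the sigma-algebra generated by the sequence. This is
   obtained by equipping [T] with that sigma-algebra and using measurability of sums there. *)
pose G := \bigcup_k sigma_of (X k).
have mXG k : measurable_fun [set: g_sigma_algebraType G] (X k).
  move=> _ C mC; rewrite setTI; apply: sub_sigma_algebra; exists k => //.
  by exists C => //; rewrite setTI.
have := @measurable_bmx_sum R b n _ (g_sigma_algebraType G) _ (index_enum 'I_j)
  (fun k : 'I_j => X k) (fun k => mXG k) measurableT B mB.
by rewrite setTI.
Qed.

Variables (r p : R).
Hypothesis r_gt0 : 0 < r.
Hypothesis NE : forall j : nat, P (N @^-1` [set j]) =
  (Gamma (r + j%:R) / (Gamma r * (j`!)%:R) * p `^ r * (1 - p) ^+ j)%:E.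

Definition nb_weight (j : nat) : R :=
  Gamma (r + j%:R) / (Gamma r * (j`!)%:R) * p `^ r * (1 - p) ^+ j.

(** The sign is read off from the fact that each weight is a probability. *)
Lemma nb_weight_ge0 j : 0 <= nb_weight j.
Proof. by rewrite -lee_fin -NE. Qed.

Lemma nb_weight_rec j : j.+1%:R * nb_weight j.+1 = (1 - p) * (r + j%:R) * nb_weight j.
Proof.
rewrite /nb_weight -natr1 addrA GammaD1; last by rewrite ltr_wpDr.
rewrite factS natrM !invfM exprS -natr1.
have j1 : j%:R + 1 != 0 :> R by rewrite natr1 pnatr_eq0.
(* With the inverses of [Gamma r] and of the factorial made atoms, the only denominator left for
   [field] is j + 1. *)
set G := Gamma (r + j%:R); set g := (Gamma r)^-1; set f := (j`!%:R)^-1; set e := _ ^+ j.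
set pr := p `^ r; clearbody G g f e pr; field.
by [].
Qed.

Lemma nb_weight_sum m : \sum_(j < m) nb_weight j <= 1.
Proof.
have mN j : measurable (N @^-1` [set j]).
  by rewrite -[X in measurable X]setTI; exact: measurable_funP.
rewrite -lee_fin -sumEFin.
under eq_bigr => j _ do rewrite /nb_weight -NE.
rewrite -(@measure_bigsetU _ _ _ P (fun j => N @^-1` [set j]))//.
  by apply: probability_le1; exact: bigsetU_measurable.
apply/trivIsetP => i j _ _ ij; rewrite -subset0 => w [/= e e'].
by rewrite -e -e' eqxx in ij.
Qed.

End NegativeBinomialEnsemble.

Theorem proposition3p7 (R : realType) (b : dyson) (n : nat) (n_ge1 : (1 <= n)%N)
  (haar : probability (bmx R b n) R) (haarP : is_haar haar)
  (r : R) (r_gt0 : 0 < r)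
  (q : nat -> R) (q_ge0 : forall k : nat, (1 <= k <= n)%N -> 0 <= q k)
  (q_sum : 0 < \sum_(1 <= k < n.+1) q k < 1)
  (nu : probability (bmx R b n) R)
  (nuP : is_negative_binomial_ensemble haar r q nu) :
  meixner_ensemble nu (1 / (2 * r + 1)) (2 * r / (2 * r + 1)) 0.
Proof.
move: nuP => [d [T [P [N [X [NE Xlaw iX NX nulaw]]]]]].
set p := 1 - qsum n q in NE Xlaw.
have cE : 1 - p = qsum n q by rewrite /p subKr.
have [c_gt0 c_lt1] : 0 < 1 - p /\ 1 - p < 1 by rewrite cE; apply/andP.
pose X' k := @to_projection R b n \o X k.
have mX k : measurable_fun setT (X k) by exact: measurable_funP.
have mX' k : measurable_fun setT (X' k).
  by apply: measurableT_comp (mX k); exact: measurable_to_projection.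
have X'law k : has_law P (X' k) (bernoulli_ensemble haar (fun m => q m / (1 - p))).
  move=> B mB; rewrite to_projection_law//; first exact: Xlaw.
  by rewrite Xlaw ?bernoulli_projections//; exact: measurable_projections.
have iX' : mutually_independent P X'.
  by apply: mutually_independent_comp iX; exact: measurable_to_projection.
have wt_ge0 := nb_weight_ge0 NE.
have wt_rec := nb_weight_rec p r_gt0.
have [K KE] := weights_second_moment_bound r_gt0 c_gt0 c_lt1 wt_ge0 wt_rec (nb_weight_sum NE).
apply: (@compound_meixner _ _ _ _ _ P X' mX' _ iX' _ _ (nb_weight r p) wt_ge0 nu _ K KE).
- by move=> k w; exact: to_projectionP.
- by move=> k B mB; rewrite !X'law.
- move=> U B uU mB; rewrite !X'law//; first exact: bernoulli_rotate.
  by rewrite -[X in measurable X]setTI; exact: measurable_rotate.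
- move=> B mB; rewrite -nulaw// compound_lawE//.
  apply: eq_eseriesr => j _; rewrite NE; congr (_ * _)%E.
  (* [X] and [X'] have the same marginals and are both independent sequences, so they have the same
     law as sequences, and so do their partial sums. *)
  have iXc : cylinder_independent P X.
    exact: (@cylinder_independent_reindex _ _ _ _ _ _ _ id id (fun=> erefl) iX).
  have iXc' : cylinder_independent P X'.
    exact: (@cylinder_independent_reindex _ _ _ _ _ _ _ id id (fun=> erefl) iX').
  pose E : set (seqspace (bmx R b n)) := [set x | B (\sum_(k < j) x k)].
  have mE : measurable E.
    rewrite -[E]setTI; apply: (@measurable_bmx_sum _ _ _ _ _ _ _
      (fun (k : 'I_j) (x : seqspace (bmx R b n)) => x k)) => // k.
    exact: measurable_seqspace_coord.
  apply: (eq_seq_law mX mX' iXc iXc' _ mE) => k C mC.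
  by rewrite X'law// Xlaw.
- by rewrite -mulrDl addrC divff// gt_eqF// addr_gt0// mulr_gt0.
- exact: (convolution_weights_variance r_gt0 c_gt0 wt_rec).
Qed.
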